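(* If $\xi=(p:E\to B)$ is a splitting fibration with closed cleavage $\Sigma$, then the inclusion $i:N_cE\to N_fE$ of the cleaved nerve into the fibred nerve is a weak equivalence of bisimplicial sets.
   Context: All categories are small. For a functor $p:E\to B$, an arrow $f:e\to e'$ of $E$ is cartesian if for every $g:e\to e''$ with $p(g)=p(f)$ there is a unique $h:e'\to e''$ with $p(h)=\mathrm{id}_{p(e')}$ and $hf=g$. The functor $p$ is a prefibration if for every object $e$ of $E$ and every arrow $\phi:p(e)\to b$ of $B$ there is a cartesian arrow with domain $e$ lying over $\phi$; it is a fibration if moreover cartesian arrows are closed under composition. A cleavage of $p$ is a set $\Sigma$ of cartesian arrows of $E$ such that for every object $e$ of $E$ and every $\phi:p(e)\to b$ there is a unique arrow $\Sigma_{e,\phi}$ in $\Sigma$ with domain $e$ over $\phi$. All cleavages are assumed normal, i.e. containing the identities. A cleavage is closed if it is closed under composition; a fibration admitting a closed cleavage is called splitting. A fibred map $(f,g):\xi\to\xi'$ between fibrations $p:E\to B$, $p':E'\to B'$ is a pair of functors $f:E\to E'$, $g:B\to B'$ with $p'f=gp$ and $f$ preserving cartesian arrows; the set of these is $\mathrm{Fib}(\xi,\xi')$. If cleavages $\Sigma,\Sigma'$ are given, it is a cleaved map if moreover $f(\Sigma)\subset\Sigma'$; the set of these is $\mathrm{Cliv}((\xi,\Sigma),(\xi',\Sigma'))$. Let $\underline n=\{0<\dots<n\}$, viewed as a category, and let $\square_{m,n}$ be the fibration $\mathrm{pr}_2:\underline m\times\underline n\to\underline n$ with its unique cleavage $\{(\mathrm{id},\alpha)\}$;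 this is functorial in $(m,n)\in\Delta\times\Delta$. The fibred nerve $N_fE=N_f\xi$ is the bisimplicial set $(N_f\xi)_{m,n}=\mathrm{Fib}(\square_{m,n},\xi)$ and the cleaved nerve $N_cE=N_c(\xi,\Sigma)$ is the bisimplicial set $N_c(\xi,\Sigma)_{m,n}=\mathrm{Cliv}(\square_{m,n},(\xi,\Sigma))$, with structure maps given by precomposition. Since a cleaved map is in particular a fibred map, there is a natural inclusion $i:N_cE\to N_fE$. A map of bisimplicial sets is a weak equivalence if it induces a homotopy equivalence between the geometric realizations of the diagonals. *)

(* Defs.v *)
From mathcomp Require Import all_boot all_order all_algebra generic_quotient.
From mathcomp Require Import all_classical all_reals.
From mathcomp Require Import topology normedtype.
From Stdlib Require Import Relations.Relation_Operators.

Set Implicit Arguments.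
Unset Strict Implicit.
Unset Printing Implicit Defensive.

Import Order.TTheory GRing.Theory Num.Theory.
Import numFieldNormedType.Exports.

Local Open Scope classical_set_scope.
Local Open Scope ring_scope.
Local Open Scope quotient_scope.

Record category := Category {
  ob :> Type;
  hom : ob -> ob -> Type;
  cat_id : forall x, hom x x;
  cat_comp : forall x y z, hom y z -> hom x y -> hom x z;
  cat_compA : forall x y z t (h : hom z t) (g : hom y z) (f : hom x y),
    cat_comp h (cat_comp g f) = cat_comp (cat_comp h g) f;
  cat_comp1l : forall x y (f : hom x y), cat_comp (cat_id y) f = f;
  cat_comp1r : forall x y (f : hom x y), cat_comp f (cat_id x) = f }.

Arguments hom {c} x y.
Arguments cat_id {c} x.
Arguments cat_comp {c x y z} g f.

(* Arrows with varying endpoints: an equation [Arrow f = Arrow g] includes the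
   equality of domains and codomains, so equations such as p(g) = p(f) or
   p(h) = id can be stated without transport *)
Record arrow (C : category) := Arrow {
  dom : C; cod : C; mor : hom dom cod }.
Arguments Arrow {C dom cod} mor.

Record functor (C D : category) := Functor {
  fob :> C -> D;
  fmor : forall x y : C, hom x y -> hom (fob x) (fob y);
  fmor_id : forall x, fmor (cat_id x) = cat_id (fob x);
  fmor_comp : forall x y z (g : hom y z) (f : hom x y),
    fmor (cat_comp g f) = cat_comp (fmor g) (fmor f) }.
Arguments fmor {C D} F {x y} f : rename.

Definition farrow (C D : category) (F : functor C D) (a : arrow C) : arrow D :=
  Arrow (fmor F (mor a)).

Lemma arrow_inj (C : category) (x y : C) (f g : hom x y) :
  Arrow f = Arrow g -> f = g.
Proof.
pose castA (a : arrow C) (p : dom a = x) (q : cod a = y) : hom x y :=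
  eq_rect _ (fun z => hom z y) (eq_rect _ (hom (dom a)) (mor a) _ q) _ p.
have castE a p q : Arrow f = a -> f = castA a p q.
  move=> e; case: a / e p q => p q.
  by rewrite (Prop_irrelevance p erefl) (Prop_irrelevance q erefl).
by move=> e; exact: (castE (Arrow g) erefl erefl e).
Qed.

Lemma functor_eq (C D : category) (F G : functor C D) :
  (forall a, farrow F a = farrow G a) -> F = G.
Proof.
case: F G => [fo fm f1 f2] [go gm g1 g2] e.
have eo : fo = go.
  by apply/funext => x; exact: (congr1 (@dom _) (e (Arrow (cat_id x)))).
subst go.
have em : fm = gm.
  apply: functional_extensionality_dep => x.
  apply: functional_extensionality_dep => y.
  apply: functional_extensionality_dep => f.
  exact/arrow_inj/(e (Arrow f)).
by subst gm; congr Functor; exact: Prop_irrelevance.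
Qed.

Definition functor_id (C : category) : functor C C :=
  @Functor C C id (fun _ _ => id) (fun _ => erefl) (fun _ _ _ _ _ => erefl).

Program Definition functor_comp (C D E : category)
    (G : functor D E) (F : functor C D) : functor C E :=
  @Functor C E (G \o F) (fun _ _ f => fmor G (fmor F f)) _ _.
Next Obligation. by move=> *; rewrite /= !fmor_id. Qed.
Next Obligation. by move=> *; rewrite /= !fmor_comp. Qed.

Definition prod_cat (C D : category) : category.
Proof.
refine (@Category (C * D)%type (fun x y => hom x.1 y.1 * hom x.2 y.2)%type
  (fun x => (cat_id x.1, cat_id x.2))
  (fun x y z g f => (cat_comp g.1 f.1, cat_comp g.2 f.2)) _ _ _).
- by move=> x y z t h g f; rewrite !cat_compA.
- by move=> x y [f g]; rewrite /= !cat_comp1l.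
- by move=> x y [f g]; rewrite /= !cat_comp1r.
Defined.

Definition cat_pr1 (C D : category) : functor (prod_cat C D) C :=
  @Functor (prod_cat C D) C fst (fun _ _ f => f.1) (fun _ => erefl)
    (fun _ _ _ _ _ => erefl).

Definition cat_pr2 (C D : category) : functor (prod_cat C D) D :=
  @Functor (prod_cat C D) D snd (fun _ _ f => f.2) (fun _ => erefl)
    (fun _ _ _ _ _ => erefl).

Program Definition prod_functor (C C' D D' : category)
    (F : functor C D) (G : functor C' D') :
    functor (prod_cat C C') (prod_cat D D') :=
  @Functor (prod_cat C C') (prod_cat D D') (fun x => (F x.1, G x.2))
    (fun _ _ f => (fmor F f.1, fmor G f.2)) _ _.
Next Obligation. by move=> *; rewrite /= !fmor_id. Qed.
Next Obligation. by move=> *; rewrite /= !fmor_comp. Qed.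

Program Definition poset_cat d (P : porderType d) : category :=
  @Category P (fun x y => (x <= y)%O) (fun x => lexx x)
    (fun x y z g f => le_trans f g) _ _ _.
Next Obligation. by move=> *; exact: Prop_irrelevance. Qed.
Next Obligation. by move=> *; exact: Prop_irrelevance. Qed.
Next Obligation. by move=> *; exact: Prop_irrelevance. Qed.

Lemma poset_hom_eq d (P : porderType d) (x y : poset_cat P) (f g : hom x y) :
  f = g.
Proof. exact: (@Prop_irrelevance (x <= y)%O). Qed.

Program Definition poset_functor d d' (P : porderType d) (Q : porderType d')
    (f : {omorphism P -> Q}) : functor (poset_cat P) (poset_cat Q) :=
  @Functor (poset_cat P) (poset_cat Q) f (fun x y => @omorph_le _ _ _ _ f x y)
    _ _.
Next Obligation. by move=> *; exact: poset_hom_eq. Qed.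
Next Obligation. by move=> *; exact: poset_hom_eq. Qed.

(* Cartesian arrows are lifts starting from their domain, and the factorization
   is only required against arrows g with p(g) = p(f) *)
Definition cartesian (E B : category) (p : functor E B) (e e' : E)
    (f : hom e e') : Prop :=
  forall (e'' : E) (g : hom e e''),
    Arrow (fmor p g) = Arrow (fmor p f) ->
    exists! h : hom e' e'',
      Arrow (fmor p h) = Arrow (cat_id (p e')) /\ cat_comp h f = g.

Definition prefibration_prop (E B : category) (p : functor E B) : Prop :=
  forall (e : E) (b : B) (phi : hom (p e) b),
    exists (e' : E) (f : hom e e'),
      cartesian p f /\ Arrow (fmor p f) = Arrow phi.

Definition fibration_prop (E B : category) (p : functor E B) : Prop :=
  prefibration_prop p /\
  forall (x y z : E) (f : hom x y) (g : hom y z),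
    cartesian p f -> cartesian p g -> cartesian p (cat_comp g f).

Record fibration := Fibration {
  total : category;
  base : category;
  proj : functor total base;
  fibrationP : fibration_prop proj }.

Record cleavage (xi : fibration) := Cleavage {
  cleavage_set : set (arrow (total xi));
  cleavage_cartesian :
    forall a, cleavage_set a -> cartesian (proj xi) (mor a);
  cleavage_lift : forall (e : total xi) (b : base xi) (phi : hom (proj xi e) b),
    exists! a : arrow (total xi),
      [/\ cleavage_set a, dom a = e & farrow (proj xi) a = Arrow phi];
  cleavage_normal : forall e : total xi, cleavage_set (Arrow (cat_id e)) }.

Definition closed_cleavage (xi : fibration) (S : cleavage xi) : Prop :=
  forall (x y z : total xi) (f : hom x y) (g : hom y z),
    cleavage_set S (Arrow f) -> cleavage_set S (Arrow g) ->
    cleavage_set S (Arrow (cat_comp g f)).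

Record fibred_map (xi xi' : fibration) := FibredMap {
  fib_total : functor (total xi) (total xi');
  fib_base : functor (base xi) (base xi');
  fib_comm :
    functor_comp (proj xi') fib_total = functor_comp fib_base (proj xi);
  fib_cartesian : forall (x y : total xi) (f : hom x y),
    cartesian (proj xi) f -> cartesian (proj xi') (fmor fib_total f) }.

Definition cleaved (xi xi' : fibration) (S : cleavage xi) (S' : cleavage xi')
    (u : fibred_map xi xi') : Prop :=
  farrow (fib_total u) @` cleavage_set S `<=` cleavage_set S'.

Definition cleaved_map (xi xi' : fibration)
    (S : cleavage xi) (S' : cleavage xi') : Type :=
  {u : fibred_map xi xi' | cleaved S S' u}.

Lemma fibred_map_eq (xi xi' : fibration) (u v : fibred_map xi xi') :
  fib_total u = fib_total v -> fib_base u = fib_base v -> u = v.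
Proof.
case: u v => [f g c k] [f' g' c' k'] /= ef eg; subst f' g'.
by congr FibredMap; exact: Prop_irrelevance.
Qed.

Lemma cleaved_map_eq (xi xi' : fibration) (S : cleavage xi) (S' : cleavage xi')
  (u v : cleaved_map S S') : sval u = sval v -> u = v.
Proof.
case: u v => [u hu] [v hv] /= e; subst v.
by congr exist; exact: Prop_irrelevance.
Qed.

Lemma functor_compA (A B C D : category) (H : functor C D) (G : functor B C)
  (F : functor A B) :
  functor_comp H (functor_comp G F) = functor_comp (functor_comp H G) F.
Proof. exact: functor_eq. Qed.

Definition fibred_comp (xi xi' xi'' : fibration)
  (v : fibred_map xi' xi'') (u : fibred_map xi xi') : fibred_map xi xi''.
Proof.
refine (@FibredMap xi xi'' (functor_comp (fib_total v) (fib_total u))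
  (functor_comp (fib_base v) (fib_base u)) _ _).
- by rewrite functor_compA fib_comm -functor_compA fib_comm functor_compA.
- by move=> x y f cf; do 2 apply: fib_cartesian.
Defined.

Lemma cleaved_comp (xi xi' xi'' : fibration) (S : cleavage xi)
  (S' : cleavage xi') (S'' : cleavage xi'') (v : fibred_map xi' xi'')
  (u : fibred_map xi xi') :
  cleaved S S' u -> cleaved S' S'' v -> cleaved S S'' (fibred_comp v u).
Proof.
move=> cu cv _ [a Sa <-]; apply: cv; exists (farrow (fib_total u) a) => //.
by apply: cu; exists a.
Qed.

Definition delta (m n : nat) : Type := {omorphism 'I_m.+1 -> 'I_n.+1}.
Definition delta_id (n : nat) : delta n n := idfun.
Definition delta_comp (l m n : nat) (b : delta m n) (a : delta l m) :
  delta l n := b \o a.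

Definition ord_cat (n : nat) : category := poset_cat 'I_n.+1.

Definition square_total (m n : nat) : category :=
  prod_cat (ord_cat m) (ord_cat n).

Lemma poset_arrow_eq d (P : porderType d) (a b : arrow (poset_cat P)) :
  dom a = dom b -> cod a = cod b -> a = b.
Proof.
case: a b => [x y f] [x' y' g] /= ex ey; subst x' y'.
by rewrite (poset_hom_eq f g).
Qed.

Lemma square_hom_eq (m n : nat) (x y : square_total m n) (f g : hom x y) :
  f = g.
Proof. by case: f g => [a b] [c d]; congr pair; exact: poset_hom_eq. Qed.

Lemma square_arrow_eq (m n : nat) (a b : arrow (square_total m n)) :
  dom a = dom b -> cod a = cod b -> a = b.
Proof.
case: a b => [x y f] [x' y' g] /= ex ey; subst x' y'.
by rewrite (square_hom_eq f g).
Qed.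

Lemma square_cartesian (m n : nat) (x y : square_total m n) (f : hom x y) :
  cartesian (cat_pr2 (ord_cat m) (ord_cat n)) f <-> x.1 = y.1.
Proof.
split=> [cf|exy z g efg].
  pose g : @hom (square_total m n) x (x.1, y.2) := (lexx x.1, f.2).
  have [|h [_ _]] := cf (x.1, y.2) g; first exact: poset_arrow_eq.
  by apply/le_anti/andP; split; [exact: f.1 | exact: h.1].
have ez : z.2 = y.2 by exact: (congr1 (@cod _) efg).
have h1 : (y.1 <= z.1)%O by rewrite -exy; exact: g.1.
have h2 : (y.2 <= z.2)%O by rewrite ez.
exists (h1, h2); split; last by move=> h' _; exact: square_hom_eq.
by split; [exact: poset_arrow_eq | exact: square_hom_eq].
Qed.

Lemma square_fibrationP (m n : nat) :
  fibration_prop (cat_pr2 (ord_cat m) (ord_cat n)).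
Proof.
split=> [e b phi|x y z f g]; last first.
  by rewrite !square_cartesian => -> ->.
pose f : @hom (square_total m n) e (e.1, b) := (lexx e.1, phi).
exists (e.1, b), f; split; first exact/square_cartesian.
exact: poset_arrow_eq.
Qed.

Definition square (m n : nat) : fibration := Fibration (square_fibrationP m n).

Definition square_cleavage_set (m n : nat) : set (arrow (total (square m n))) :=
  [set a | exists i, farrow (cat_pr1 _ _) a = Arrow (cat_id i)].

Lemma square_cleavage_setE (m n : nat) (a : arrow (total (square m n))) :
  square_cleavage_set a <-> (dom a).1 = (cod a).1.
Proof.
split=> [[i e]|e].
  exact: etrans (congr1 (@dom _) e) (esym (congr1 (@cod _) e)).
by exists (dom a).1; apply: poset_arrow_eq.
Qed.

Definition square_cleavage (m n : nat) : cleavage (square m n).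
Proof.
apply: (@Cleavage (square m n) (@square_cleavage_set m n)).
- by move=> a /square_cleavage_setE ?; exact/square_cartesian.
- move=> e b phi.
  pose f : @hom (square_total m n) e (e.1, b) := (lexx e.1, phi).
  exists (@Arrow (square_total m n) _ _ f); split.
    by split => //; exact/square_cleavage_setE.
  move=> a [/square_cleavage_setE e1 ed ea].
  have eb : (cod a).2 = b by exact: (congr1 (@cod _) ea).
  by apply: square_arrow_eq => //=; rewrite -ed e1 -eb -surjective_pairing.
- by move=> e; exact/square_cleavage_setE.
Defined.

Lemma square_cleavage_unique (m n : nat) (S : cleavage (square m n)) :
  cleavage_set S = square_cleavage_set (m := m) (n := n).
Proof.
have sub (a : arrow (total (square m n))) :
    cleavage_set S a -> square_cleavage_set a.
  by move=> /cleavage_cartesian/square_cartesian ?; apply/square_cleavage_setE.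
apply/seteqP; split=> a; first exact: sub.
move=> Sa; have [b [[Sb db pb] _]] := cleavage_lift S (mor (farrow (proj _) a)).
have [c [_ uc]] :=
  cleavage_lift (square_cleavage m n) (mor (farrow (proj _) a)).
by rewrite -(uc a) // (uc b) //; split => //; exact: sub.
Qed.

Definition square_map (m m' n n' : nat) (a : delta m' m) (b : delta n' n) :
  fibred_map (square m' n') (square m n).
Proof.
refine (@FibredMap (square m' n') (square m n)
  (prod_functor (poset_functor a) (poset_functor b)) (poset_functor b) _ _).
- exact: functor_eq.
- by move=> x y f /square_cartesian e; apply/square_cartesian; rewrite /= e.
Defined.

Lemma square_map_cleaved (m m' n n' : nat) (a : delta m' m) (b : delta n' n) :
  cleaved (square_cleavage m' n') (square_cleavage m n) (square_map a b).
Proof.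
move=> _ [f /square_cleavage_setE ef <-]; apply/square_cleavage_setE.
by rewrite /= ef.
Qed.

Record sset := SSet {
  ss_ob :> nat -> Type;
  ss_map : forall m n, delta m n -> ss_ob n -> ss_ob m;
  ss_map_id : forall n (x : ss_ob n), ss_map (delta_id n) x = x;
  ss_map_comp : forall l m n (b : delta m n) (a : delta l m) (x : ss_ob n),
    ss_map (delta_comp b a) x = ss_map a (ss_map b x) }.
Arguments ss_map X {m n} a x : rename.

Record sset_map (X Y : sset) := SSetMap {
  ss_fun :> forall n, X n -> Y n;
  ss_fun_nat : forall m n (a : delta m n) (x : X n),
    ss_fun (ss_map X a x) = ss_map Y a (ss_fun x) }.
Arguments ss_fun {X Y} f n x : rename.

Record bisset := BiSSet {
  bs_ob :> nat -> nat -> Type;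
  bs_map : forall m m' n n',
    delta m' m -> delta n' n -> bs_ob m n -> bs_ob m' n';
  bs_map_id : forall m n (x : bs_ob m n),
    bs_map (delta_id m) (delta_id n) x = x;
  bs_map_comp : forall m m' m'' n n' n'' (a : delta m' m) (a' : delta m'' m')
      (b : delta n' n) (b' : delta n'' n') (x : bs_ob m n),
    bs_map (delta_comp a a') (delta_comp b b') x =
    bs_map a' b' (bs_map a b x) }.
Arguments bs_map X {m m' n n'} a b x : rename.

Record bisset_map (X Y : bisset) := BiSSetMap {
  bs_fun :> forall m n, X m n -> Y m n;
  bs_fun_nat : forall m m' n n' (a : delta m' m) (b : delta n' n) (x : X m n),
    bs_fun (bs_map X a b x) = bs_map Y a b (bs_fun x) }.
Arguments bs_fun {X Y} f m n x : rename.

Definition diag (X : bisset) : sset :=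
  @SSet (fun n => X n n) (fun m n a => bs_map X a a)
    (fun n => @bs_map_id X n n)
    (fun l m n b a => @bs_map_comp X _ _ _ _ _ _ b a b a).

Definition diag_map (X Y : bisset) (f : bisset_map X Y) :
    sset_map (diag X) (diag Y) :=
  @SSetMap (diag X) (diag Y) (fun n => bs_fun f n n)
    (fun m n a => @bs_fun_nat X Y f _ _ _ _ a a).

Section realization.
Variable R : realType.

Definition std_simplex (n : nat) : set 'rV[R]_n.+1 :=
  [set t | (forall i, 0 <= t 0 i) /\ \sum_i t 0 i = 1].
Arguments std_simplex n _ : clear implicits.

(* The affine map sending the vertex i to the vertex a i, in barycentric
   coordinates *)
Definition simplex_push (m n : nat) (a : delta m n) (t : 'rV[R]_m.+1) :
  'rV[R]_n.+1 := \row_j \sum_(i | a i == j) t 0 i.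

Lemma simplex_push_std (m n : nat) (a : delta m n) (t : std_simplex m) :
  simplex_push a (\val t) \in std_simplex n.
Proof.
case: t => t /=; rewrite !inE => -[t0 t1]; split.
  by move=> j; rewrite mxE sumr_ge0.
rewrite -t1 (partition_big (fun i => a i) xpredT) //=.
by apply: eq_bigr => j _; rewrite mxE.
Qed.

Definition simplex_map (m n : nat) (a : delta m n) (t : std_simplex m) :
  std_simplex n := SigSub (simplex_push_std a t).

Definition simplices (X : sset) : choiceType := {classic {n & X n}}.

(* The disjoint union of one copy of the standard n-simplex for every
   n-simplex of X, that is, the disjoint union of the products of the discrete
   space X_n with the standard n-simplex *)
Definition prerealization (X : sset) : topologicalType :=
  {s : simplices X & std_simplex (projT1 s)}.

Definition mk_prerealization (X : sset) (n : nat) (x : X n)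
    (t : std_simplex n) : prerealization X :=
  existT (fun s : simplices X => std_simplex (projT1 s) : Type)
    (existT (fun n => X n) n x) t.

Inductive glue (X : sset) : prerealization X -> prerealization X -> Prop :=
  Glue : forall m n (a : delta m n) (x : X n) (t : std_simplex m),
    glue (mk_prerealization (ss_map X a x) t)
         (mk_prerealization x (simplex_map a t)).

Definition glue_rel (X : sset) : rel (prerealization X) :=
  fun u v => `[< clos_refl_sym_trans _ (@glue X) u v >].

Lemma glue_rel_refl (X : sset) : reflexive (@glue_rel X).
Proof. by move=> u; apply/asboolP; exact: rst_refl. Qed.

Lemma glue_rel_sym (X : sset) : symmetric (@glue_rel X).
Proof. by move=> u v; apply/asboolP/asboolP; exact: rst_sym. Qed.

Lemma glue_rel_trans (X : sset) : transitive (@glue_rel X).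
Proof.
move=> u v w /asboolP h /asboolP k; apply/asboolP; exact: rst_trans h k.
Qed.

Canonical glue_equiv (X : sset) :=
  EquivRel (@glue_rel X) (@glue_rel_refl X) (@glue_rel_sym X)
    (@glue_rel_trans X).

Definition realization (X : sset) : topologicalType :=
  quotient_topology {eq_quot (glue_equiv X)}.

Definition realization_pi (X : sset) (u : prerealization X) : realization X :=
  \pi_{eq_quot (glue_equiv X)} u.

Definition realization_repr (X : sset) (q : realization X) : prerealization X :=
  repr (q : {eq_quot (glue_equiv X)}).

Definition prerealization_map (X Y : sset) (f : sset_map X Y)
    (u : prerealization X) : prerealization Y :=
  mk_prerealization (ss_fun f _ (projT2 (projT1 u))) (projT2 u).

Lemma prerealization_map_glue (X Y : sset) (f : sset_map X Y)
    (u v : prerealization X) :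
  glue_rel u v -> glue_rel (prerealization_map f u) (prerealization_map f v).
Proof.
move=> /asboolP h; apply/asboolP.
elim: h => {u v} [_ _ [m n a x t]|u|u v _|u v w _ h _ k].
- apply: rst_step; rewrite /prerealization_map /= ss_fun_nat; exact: Glue.
- exact: rst_refl.
- exact: rst_sym.
- exact: rst_trans h k.
Qed.

Definition realization_map (X Y : sset) (f : sset_map X Y)
    (q : realization X) : realization Y :=
  realization_pi (prerealization_map f (realization_repr q)).

Lemma realization_mapE (X Y : sset) (f : sset_map X Y) (u : prerealization X) :
  realization_map f (realization_pi u) =
  realization_pi (prerealization_map f u).
Proof.
apply/eqmodP/prerealization_map_glue/(@eqmodP _ (glue_equiv X)).
exact: reprK.
Qed.

(* Only the values of H on T x [0, 1] matter *)
Definition homotopic (T U : topologicalType) (f g : T -> U) : Prop :=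
  exists H : T * R -> U,
    [/\ {within [set: T] `*` `[0, 1], continuous H},
        forall x, H (x, 0) = f x & forall x, H (x, 1) = g x].

Definition homotopy_equivalence (T U : topologicalType) (f : T -> U) : Prop :=
  continuous f /\
  exists g : U -> T,
    [/\ continuous g, homotopic (g \o f) idfun & homotopic (f \o g) idfun].

Definition weak_equivalence (X Y : bisset) (f : bisset_map X Y) : Prop :=
  homotopy_equivalence (realization_map (diag_map f)).

End realization.

Arguments std_simplex R n _ : clear implicits.

Lemma square_map_id (xi : fibration) (m n : nat)
    (u : fibred_map (square m n) xi) :
  fibred_comp u (square_map (delta_id m) (delta_id n)) = u.
Proof.
apply: fibred_map_eq; apply: functor_eq => a.
  have e : farrow (fib_total (square_map (delta_id m) (delta_id n))) a = a.
    by case: a => [[i j] [k l] f]; exact: square_arrow_eq.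
  exact: (congr1 (farrow (fib_total u)) e).
have e : farrow (fib_base (square_map (delta_id m) (delta_id n))) a = a.
  exact: poset_arrow_eq.
exact: (congr1 (farrow (fib_base u)) e).
Qed.

Lemma square_map_comp (xi : fibration) (m m' m'' n n' n'' : nat)
    (a : delta m' m) (a' : delta m'' m') (b : delta n' n) (b' : delta n'' n')
    (u : fibred_map (square m n) xi) :
  fibred_comp u (square_map (delta_comp a a') (delta_comp b b')) =
  fibred_comp (fibred_comp u (square_map a b)) (square_map a' b').
Proof.
apply: fibred_map_eq; apply: functor_eq => f.
  have e : farrow (fib_total (square_map (delta_comp a a') (delta_comp b b'))) f
    = farrow (fib_total (square_map a b))
        (farrow (fib_total (square_map a' b')) f) by exact: square_arrow_eq.
  exact: (congr1 (farrow (fib_total u)) e).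
have e : farrow (fib_base (square_map (delta_comp a a') (delta_comp b b'))) f
  = farrow (fib_base (square_map a b))
      (farrow (fib_base (square_map a' b')) f) by exact: poset_arrow_eq.
exact: (congr1 (farrow (fib_base u)) e).
Qed.

Definition fibred_nerve (xi : fibration) : bisset :=
  @BiSSet (fun m n => fibred_map (square m n) xi)
    (fun m m' n n' a b u => fibred_comp u (square_map a b))
    (@square_map_id xi) (@square_map_comp xi).

Definition cleaved_nerve_map (xi : fibration) (S : cleavage xi)
    (m m' n n' : nat) (a : delta m' m) (b : delta n' n)
    (u : cleaved_map (square_cleavage m n) S) :
    cleaved_map (square_cleavage m' n') S :=
  exist _ (fibred_comp (sval u) (square_map a b))
    (cleaved_comp (@square_map_cleaved m m' n n' a b) (svalP u)).

Lemma cleaved_nerve_map_id (xi : fibration) (S : cleavage xi) (m n : nat)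
    (u : cleaved_map (square_cleavage m n) S) :
  cleaved_nerve_map (delta_id m) (delta_id n) u = u.
Proof. by apply: cleaved_map_eq; exact: square_map_id. Qed.

Lemma cleaved_nerve_map_comp (xi : fibration) (S : cleavage xi)
    (m m' m'' n n' n'' : nat)
    (a : delta m' m) (a' : delta m'' m') (b : delta n' n) (b' : delta n'' n')
    (u : cleaved_map (square_cleavage m n) S) :
  cleaved_nerve_map (delta_comp a a') (delta_comp b b') u =
  cleaved_nerve_map a' b' (cleaved_nerve_map a b u).
Proof. by apply: cleaved_map_eq; exact: square_map_comp. Qed.

Definition cleaved_nerve (xi : fibration) (S : cleavage xi) : bisset :=
  @BiSSet (fun m n => cleaved_map (square_cleavage m n) S)
    (@cleaved_nerve_map xi S)
    (@cleaved_nerve_map_id xi S) (@cleaved_nerve_map_comp xi S).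

Definition nerve_inclusion (xi : fibration) (S : cleavage xi) :
    bisset_map (cleaved_nerve S) (fibred_nerve xi) :=
  @BiSSetMap (cleaved_nerve S) (fibred_nerve xi) (fun _ _ u => sval u)
    (fun _ _ _ _ _ _ _ => erefl).

(* Main.v *)
From HB Require Import structures.
From mathcomp Require Import all_boot all_order all_algebra generic_quotient.
From mathcomp Require Import all_classical all_reals.
From mathcomp Require Import topology normedtype.
From mathcomp Require Import ring lra zify.
From Stdlib Require Import Relations.Relation_Operators.
Require Import Defs.

Set Implicit Arguments.
Unset Strict Implicit.
Unset Printing Implicit Defensive.

Import Order.TTheory GRing.Theory Num.Theory.
Import numFieldNormedType.Exports.

Local Open Scope classical_set_scope.
Local Open Scope ring_scope.

(** Write [x(i,j)] for the entries of a bisimplex of the fibred nerve: [i] is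
    the vertical index, [j] the horizontal one, and [b(j)] is the object of the
    base under column [j].

    The obstacle to straightening [x] along the cleavage is that the obvious
    recipe, pushing the first column forward, does not commute with the face
    that forgets the first column. Pushing each diagonal entry [x(i,i)] forward
    to [b(j)] for [i <= j] is compatible with all simplicial operators, but it
    only reaches the part of the square above the diagonal. So let
    [straighten x] be [x] with its entries above the diagonal replaced by these
    pushforwards. This is natural ([straighten_natural]). It fixes cleaved
    squares ([straighten_cleaved_map]). It is simplicially homotopic to the
    identity, because the comparison from the pushforward of [x(i,i)] to
    [x(i,j)] is vertical: the operator argument of [straighten] says which rows
    to straighten, the others being kept. Finally, the cleavage being closed, a block
    of rows and columns of [straighten x] in which every row index is at most
    every column index is cleaved ([straighten_cleaved]).

    Such blocks suffice after a subdivision. A point [t] of the [n]-simplex is a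
    nondecreasing step function from the unit interval to [0..n]; restrict it to
    each half of the interval and rescale to get its front half [L t] and its
    back half [R t]. Every vertex that carries [L t] is at most every vertex
    that carries [R t] ([front_back_support]). Since the realization of the
    diagonal of a bisimplicial set has points with independent vertical and
    horizontal coordinates, the point of [straighten x] with coordinates
    [(L t, R t)] makes sense, and it lies in a cleaved block. This defines a map
    from the realization of the fibred nerve to that of the cleaved nerve. Both
    composites with the inclusion are homotopic to the identity: deform
    [(L t, R t)] to [(t, t)] ([spread_homotopy]) and undo the
    straightening ([realize_homotopy]). This formal part of the argument is
    [deformation_weak_equivalence].

    A point with two prescribed coordinates [s] and [r] is a simplex together
    with weights that push forward to [s] and to [r]. Such weights on a chain of
    pairs of vertices are unique, the coupling of two step functions on the same
    interval, and depend continuously on [(s, r)]; as only finitely many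
    supports occur, so does the point ([coupled_map]). *)

(** * Maps on geometric realizations *)

Definition cell_point (R : realType) (X : sset) (n : nat) (x : X n)
    (t : std_simplex R n) : realization R X :=
  realization_pi (mk_prerealization x t).

Lemma continuous_pair (T U V : topologicalType) (f : T -> U) (g : T -> V) :
  continuous f -> continuous g -> continuous (fun z => (f z, g z)).
Proof. by move=> cf cg z; apply: cvg_pair; [exact: cf|exact: cg]. Qed.

Lemma continuous_compose (T U V : topologicalType) (f : T -> U) (g : U -> V) :
  continuous f -> continuous g -> continuous (g \o f).
Proof. by move=> cf cg z; apply: continuous_comp; [exact: cf|exact: cg]. Qed.

Section realization_facts.
Variable R : realType.

Lemma cell_point_glue (X : sset) m n (a : delta m n) (x : X n)
    (t : std_simplex R m) :
  cell_point (ss_map X a x) t = cell_point x (simplex_map a t).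
Proof. by apply/eqmodP/asboolP/rst_step/Glue. Qed.

Lemma cell_point_continuous (X : sset) n (x : X n) :
  continuous (@cell_point R X n x).
Proof.
move=> t; apply: (@continuous_comp _ _ _ (mk_prerealization x)
  (@realization_pi R X)).
  exact: (@existT_continuous _ (fun s : simplices X => std_simplex R (projT1 s))
    (existT _ n x)).
exact: pi_continuous.
Qed.

Lemma cell_point_surj (X : sset) (q : realization R X) :
  exists n (x : X n) t, q = cell_point x t.
Proof.
rewrite -[q]reprK; case: (repr q) => -[n x] t; by exists n, x, t.
Qed.

Lemma realization_map_point (X Y : sset) (f : sset_map X Y) n (x : X n)
    (t : std_simplex R n) :
  realization_map f (cell_point x t) = cell_point (ss_fun f n x) t.
Proof. exact: realization_mapE. Qed.

Import ArrowAsCompactOpen.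

(** Compatible maps on the cells times a parameter space glue to a continuous
    map on the realization times that space. The product with a locally compact
    Hausdorff space preserves quotient maps, seen here through currying into
    the compact-open topology. *)
Lemma realization_lift_param (X : sset) (V W : topologicalType)
    (H : forall n, X n -> std_simplex R n * V -> W) :
    locally_compact [set: V] -> hausdorff_space V ->
    (forall n x, continuous (H n x)) ->
    (forall m n (a : delta m n) (x : X n) t v,
      H m (ss_map X a x) (t, v) = H n x (simplex_map a t, v)) ->
  exists G : realization R X * V -> W, continuous G /\
    forall n (x : X n) t v, G (cell_point x t, v) = H n x (t, v).
Proof.
move=> lcV hV cH glueH.
pose h (u : prerealization R X) : {compact-open, V -> W} :=
  curry (H _ (projT2 (projT1 u))) (projT2 u).
have hglue u v : glue_rel u v -> h u = h v.
  move=> /asboolP; elim=> {u v} [_ _ [m n a x t]|u|u v _ ->|u v w _ -> _ ->] //.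
  by apply/funext => v; exact: glueH.
have ch : continuous h.
  apply: (@sigT_continuous _ (fun s : simplices X => std_simplex R (projT1 s))
    {compact-open, V -> W} (fun s => curry (H _ (projT2 s)))) => -[n x].
  by have [] := continuous_curry (cH n x).
pose g : realization R X -> V -> W := h \o repr.
have gE n (x : X n) t v : g (cell_point x t) v = H n x (t, v).
  rewrite /g /= (_ : h _ = h (mk_prerealization x t)) //.
  by apply/hglue/(@eqmodP _ (glue_equiv R X)); exact: reprK.
exists (uncurry g); split; last by move=> n x t v; exact: gE.
apply: continuous_uncurry => //; last first.
  move=> q; have [n [x [t ->]]] := cell_point_surj q.
  rewrite (_ : g _ = curry (H n x) t); last by apply/funext => v; exact: gE.
  by have [_] := continuous_curry (cH n x).
apply: (@repr_comp_continuous _ _ _ h) => //.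
move=> u v /eqP/(@eqmodP _ (glue_equiv R X)) uv; apply/eqP; exact: hglue.
Qed.

Lemma realization_lift (X : sset) (W : topologicalType)
    (H : forall n, X n -> std_simplex R n -> W) :
    (forall n x, continuous (H n x)) ->
    (forall m n (a : delta m n) (x : X n) t,
      H m (ss_map X a x) t = H n x (simplex_map a t)) ->
  exists G : realization R X -> W, continuous G /\
    forall n (x : X n) t, G (cell_point x t) = H n x t.
Proof.
move=> cH glueH.
have [||n x|m n a x t v|G [cG GE]] := @realization_lift_param X R W
  (fun n x u => H n x u.1).
- exact: locally_compactR.
- exact: Rhausdorff.
- move=> [t v]; apply: (@continuous_comp _ _ _ fst (H n x)) => //.
    exact: cvg_fst.
  exact: cH.
- exact: glueH.
exists (fun q => G (q, 0)); split=> [q|n x t]; last by rewrite GE.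
apply: (@continuous_comp _ _ _ (fun q => (q, 0)) G).
  apply: continuous_pair => z; [exact: cvg_id|apply: cst_continuous].
exact: cG.
Qed.

Lemma realization_map_continuous (X Y : sset) (f : sset_map X Y) :
  continuous (@realization_map R X Y f).
Proof.
have [n x|m n a x t|G [cG GE]] := @realization_lift X (realization R Y)
  (fun n x t => cell_point (ss_fun f n x) t).
- exact: cell_point_continuous.
- by rewrite ss_fun_nat cell_point_glue.
suff -> : realization_map f = G by [].
apply/funext => q; have [n [x [t ->]]] := cell_point_surj q.
by rewrite GE realization_map_point.
Qed.

(** The second hypothesis is continuity on each piece, in a form that
    survives when a piece is empty and carries no formula for [G]. *)
Lemma finite_closed_pasting (T W : topologicalType) (I : finType)
    (D : I -> set T) (G : T -> W) :
    (forall z, exists i, D i z) ->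
    (forall i C, closed C -> closed (D i `&` G @^-1` C)) ->
  continuous G.
Proof.
move=> cov cD; apply/continuous_closedP => C cC.
rewrite (_ : _ @^-1` _ = \bigcup_(i in [set: I]) (D i `&` G @^-1` C)).
  by apply: closed_bigcup => [|i _]; [exact: finite_finset|exact: cD].
apply/seteqP; split=> [z Gz|z [i _ []]//].
by have [i Di] := cov z; exists i.
Qed.

Lemma std_simplex_continuous (T : topologicalType) n (f : T -> std_simplex R n) :
    (forall i, continuous (fun z => \val (f z) 0 i)) -> continuous f.
Proof.
move=> cf; apply: continuous_comp_initial => z A /= [P zP sPA].
near=> w; apply: sPA => i j; move: i j; near: w.
apply: filter_forall => i; apply: filter_forall => j.
by rewrite (ord1 i); apply: cf; rewrite -(ord1 i); exact: zP.
Unshelve. all: by end_near. Qed.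

End realization_facts.

(** * Operators and points of simplices *)

Lemma delta_ext m n (a b : delta m n) : (forall i, a i = b i) -> a = b.
Proof.
case: a b => [f [[Hf]]] [g [[Hg]]] /= e.
have {}e : f = g by apply/funext.
by subst g; rewrite (Prop_irrelevance Hf Hg).
Qed.

Definition mk_delta m n (f : 'I_m.+1 -> 'I_n.+1)
    (f_homo : {homo f : i j / (i <= j)%N}) : delta m n :=
  HB.pack_for {omorphism 'I_m.+1 -> 'I_n.+1} f
    (Order.isOrderMorphism.Build _ 'I_m.+1 _ 'I_n.+1 f f_homo).

Lemma delta_homo m n (a : delta m n) (i j : 'I_m.+1) :
  (i <= j)%N -> (a i <= a j)%N.
Proof. exact: (@omorph_le _ _ _ _ a i j). Qed.

Lemma delta_initial_segment m n (a : delta m n) (k : nat) :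
  exists2 l : nat, (l <= m.+1)%N & forall i, (a i < k)%N = (i < l)%N.
Proof.
case: (pickP (fun i => k <= a i)%N) => [i0 ki0|none]; last first.
  by exists m.+1 => // i; rewrite ltn_ord ltnNge none.
case: (@arg_minnP _ i0 (fun i => k <= a i)%N (fun i => i : nat) ki0) => l kl lmin.
exists l; first exact: ltnW.
move=> i; apply/idP/idP; apply: contraLR; rewrite -!leqNgt => h.
  exact: leq_trans kl (delta_homo a h).
exact: lmin.
Qed.

(** An index outside [S] goes to the largest element of [S] below it, or to the
    least element of [S] when there is none. *)
Lemma delta_retract n (S : {set 'I_n.+1}) (i0 : 'I_n.+1) : i0 \in S ->
  exists d : delta n n, (forall i, d i \in S) /\ forall i, i \in S -> d i = i.
Proof.
move=> Si0.
case: (@arg_minnP _ i0 (fun i => i \in S) (fun i => i : nat) Si0).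
move=> b Sb bmin.
pose P (i j : 'I_n.+1) := (j \in S) && ((j <= i) || (j == b))%N.
have Pb i : P i b by rewrite /P Sb eqxx orbT.
pose f i := [arg max_(j > b | P i j) (j : nat)].
have fP i : P i (f i) /\ forall j, P i j -> (j <= f i)%N.
  by rewrite /f; case: arg_maxnP => // j.
have f_homo : {homo f : i j / (i <= j)%N}.
  move=> i j ij; apply: (fP j).2; case: (fP i) => /andP[Sfi fi] _.
  rewrite /P Sfi /=; case/orP: fi => [fi|->]; last by rewrite orbT.
  by rewrite (leq_trans fi ij).
exists (mk_delta f_homo); split=> i /=; first by case/andP: (fP i).1.
move=> Si; apply/ord_inj/anti_leq.
case: (fP i) => /andP[_ /orP h] fmax; rewrite fmax ?/P ?Si ?leqnn // andbT.
by case: h => // /eqP ->; exact: bmin.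
Qed.

Section cumulative.
Variable R : realType.

Lemma simplex_ge0 n (t : std_simplex R n) i : 0 <= val t 0 i.
Proof. by case: t => t /=; rewrite inE => -[]. Qed.

Lemma simplex_sum n (t : std_simplex R n) : \sum_i val t 0 i = 1.
Proof. by case: t => t /=; rewrite inE => -[]. Qed.

Lemma simplex_ext n (s t : std_simplex R n) :
  (forall i, val s 0 i = val t 0 i) -> s = t.
Proof. by move=> e; apply/val_inj/rowP. Qed.

Lemma simplex_neq0 n (t : std_simplex R n) : exists i, val t 0 i != 0.
Proof.
apply/existsP; apply: contraT; rewrite negb_exists => /forallP h.
have := simplex_sum t; rewrite big1 => [/eqP|i _]; first by rewrite eq_sym oner_eq0.
by apply/eqP; move: (h i); rewrite negbK.
Qed.

Definition mk_simplex n (f : 'I_n.+1 -> R) (f_ge0 : forall i, 0 <= f i)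
    (f_sum : \sum_i f i = 1) : std_simplex R n.
Proof.
apply: (@SigSub _ _ _ (\row_i f i)).
rewrite inE; split=> [i|]; first by rewrite mxE.
by rewrite -f_sum; apply: eq_bigr => i _; rewrite mxE.
Defined.

Lemma mk_simplexE n (f : 'I_n.+1 -> R) f_ge0 f_sum i :
  val (@mk_simplex n f f_ge0 f_sum) 0 i = f i.
Proof. by rewrite /= mxE. Qed.

Lemma simplex_mapE m n (a : delta m n) (t : std_simplex R m) j :
  val (simplex_map a t) 0 j = \sum_(i | a i == j) val t 0 i.
Proof. by rewrite /= mxE. Qed.

Definition cumul n (t : std_simplex R n) (k : nat) : R :=
  \sum_(i < n.+1 | (i < k)%N) val t 0 i.

Lemma cumul0 n (t : std_simplex R n) : cumul t 0 = 0.
Proof. by rewrite /cumul big_pred0. Qed.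

Lemma cumulS n (t : std_simplex R n) (i : 'I_n.+1) :
  cumul t i.+1 = cumul t i + val t 0 i.
Proof.
rewrite /cumul (bigD1 i) //= addrC; congr (_ + _).
by apply: eq_bigl => j; rewrite ltnS ltn_neqAle andbC.
Qed.

Lemma cumul_ge n (t : std_simplex R n) k : (n < k)%N -> cumul t k = 1.
Proof.
move=> nk; rewrite -(simplex_sum t); apply: eq_bigl => i.
exact: leq_trans (ltn_ord i) nk.
Qed.

Lemma cumul_le n (t : std_simplex R n) k l : (k <= l)%N -> cumul t k <= cumul t l.
Proof.
move=> kl; rewrite /cumul big_mkcond [leRHS]big_mkcond ler_sum // => i _.
case: ltnP => ik; first by rewrite (leq_trans ik kl).
by case: ifP => // _; exact: simplex_ge0.
Qed.

Lemma cumul_ge0 n (t : std_simplex R n) k : 0 <= cumul t k.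
Proof. by rewrite -(cumul0 t); exact: cumul_le. Qed.

Lemma cumul_le1 n (t : std_simplex R n) k : cumul t k <= 1.
Proof.
by rewrite -(cumul_ge t (leq_maxl n.+1 k)); apply/cumul_le/leq_maxr.
Qed.

Lemma cumul_ext n (s t : std_simplex R n) :
  (forall k, cumul s k = cumul t k) -> s = t.
Proof.
move=> e; apply: simplex_ext => i; apply: (addrI (cumul s i)).
by rewrite -cumulS !e cumulS.
Qed.

Lemma cumul_map m n (a : delta m n) (t : std_simplex R m) k :
  cumul (simplex_map a t) k = \sum_(i | (a i < k)%N) val t 0 i.
Proof.
rewrite /cumul (partition_big (fun i => a i) (fun j => j < k)%N) //=.
apply: eq_bigr => j jk; rewrite mxE; apply: eq_bigl => i.
by rewrite andbC; case: eqP => //= ->; rewrite jk.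
Qed.

(** The fibres of a monotone map are intervals, so its action on cumulative
    weights is a reindexing that does not depend on the point; this is what
    makes reparametrizations natural. *)
Lemma cumul_map_segment m n (a : delta m n) k :
  exists l, forall t : std_simplex R m, cumul (simplex_map a t) k = cumul t l.
Proof.
have [l _ al] := delta_initial_segment a k; exists l => t.
by rewrite cumul_map; apply: eq_bigl => i; exact: al.
Qed.

Lemma coordinate_continuous n i :
  continuous (fun t : std_simplex R n => val t 0 i).
Proof.
move=> t; apply: (@continuous_comp (std_simplex R n) 'rV[R]_n.+1 R val
  (fun M => M 0 i)).
  exact: initial_continuous.
exact: coord_continuous.
Qed.

Lemma sum_continuous (T : topologicalType) (I : finType) (P : pred I)
    (f : I -> T -> R) :
  (forall i, continuous (f i)) -> continuous (fun z => \sum_(i | P i) f i z).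
Proof.
move=> cf z; apply: cvg_big => [|i _]; [exact: add_continuous|exact: cf].
Qed.

Lemma cumul_continuous n k : continuous (fun t : std_simplex R n => cumul t k).
Proof. by apply: sum_continuous => i; exact: coordinate_continuous. Qed.

Lemma simplex_map_comp l m n (b : delta m n) (a : delta l m)
    (t : std_simplex R l) :
  simplex_map (delta_comp b a) t = simplex_map b (simplex_map a t).
Proof.
apply: simplex_ext => j; rewrite !simplex_mapE.
rewrite (partition_big (fun i => a i) (fun j' => b j' == j)) //=.
apply: eq_bigr => j' bj; rewrite mxE; apply: eq_bigl => i.
by rewrite andbC; case: eqP => //= ->.
Qed.

Lemma simplex_map_id n (t : std_simplex R n) : simplex_map (delta_id n) t = t.
Proof.
by apply: simplex_ext => j; rewrite simplex_mapE big_pred1_eq.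
Qed.

Lemma simplex_map_fix m n (a b : delta m n) (t : std_simplex R m) :
  (forall i, val t 0 i != 0 -> a i = b i) -> simplex_map a t = simplex_map b t.
Proof.
move=> e; apply: simplex_ext => j; rewrite !simplex_mapE.
rewrite big_mkcond [RHS]big_mkcond; apply: eq_bigr => i _.
have [->|/e -> //] := eqVneq (val t 0 i) 0; by rewrite !if_same.
Qed.

End cumulative.

(** * Points with two prescribed coordinates *)

Section coupling.
Variable R : realType.

Definition mincumul p q (s : std_simplex R p) (r : std_simplex R q) (i j : nat) :=
  Num.min (cumul s i) (cumul r j).

(** The weight of the pair [v] when [s] and [r] are viewed as step functions on
    the unit interval: the length of the intersection of the [v.1]-th step of
    [s] with the [v.2]-th step of [r], as a second difference of [mincumul],
    the length of the intersection of two initial segments. *)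
Definition coupling p q (s : std_simplex R p) (r : std_simplex R q)
    (v : 'I_p.+1 * 'I_q.+1) : R :=
  mincumul s r v.1.+1 v.2.+1 - mincumul s r v.1 v.2.+1 -
  mincumul s r v.1.+1 v.2 + mincumul s r v.1 v.2.

(** On a chain both conditions cut out initial segments, which are nested, so
    the sum is the smaller of the two cumulative weights. *)
Lemma mincumul_chain m p q (a : delta m p) (b : delta m q)
    (t : std_simplex R m) i j :
  \sum_(h | ((a h < i) && (b h < j))%N) val t 0 h =
  mincumul (simplex_map a t) (simplex_map b t) i j.
Proof.
rewrite /mincumul !cumul_map.
have [k _ ak] := delta_initial_segment a i.
have [l _ bl] := delta_initial_segment b j.
rewrite (eq_bigl _ _ ak) (eq_bigl _ _ bl) -/(cumul t k) -/(cumul t l).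
have e h : ((a h < i) && (b h < j))%N = (h < minn k l)%N.
  by rewrite ak bl leq_min.
rewrite (eq_bigl _ _ e) -/(cumul t (minn k l)).
have [kl|lk] := leqP k l; first by rewrite min_l // cumul_le.
by rewrite min_r // cumul_le // ltnW.
Qed.

(** Weights on a chain of pairs are determined by their two marginals. *)
Lemma coupling_chain m p q (a : delta m p) (b : delta m q)
    (t : std_simplex R m) v :
  \sum_(h | (a h, b h) == v) val t 0 h =
  coupling (simplex_map a t) (simplex_map b t) v.
Proof.
case: v => i j; rewrite /coupling -!mincumul_chain /=.
rewrite big_mkcond (big_mkcond (fun h => (a h < i.+1) && (b h < j.+1))%N).
rewrite (big_mkcond (fun h => (a h < i) && (b h < j.+1))%N).
rewrite (big_mkcond (fun h => (a h < i.+1) && (b h < j))%N).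
rewrite (big_mkcond (fun h => (a h < i) && (b h < j))%N).
rewrite -!sumrB -big_split /=; apply: eq_bigr => h _.
rewrite (_ : ((a h, b h) == (i, j)) = ((a h == i :> nat) && (b h == j :> nat))) //.
rewrite (ltnS (a h)) (ltnS (b h)) (leq_eqVlt (a h)) (leq_eqVlt (b h)).
case: (ltngtP (a h) i) => _; case: (ltngtP (b h) j) => _ //=; ring.
Qed.

Section two_simplices.
Variables (p q : nat) (s : std_simplex R p) (r : std_simplex R q).

Lemma coupling_ge0 v : 0 <= coupling s r v.
Proof.
case: v => i j; rewrite /coupling /mincumul /=.
have := cumul_le s (leqnSn i); have := cumul_le r (leqnSn j).
by rewrite !minEle; do ?[case: ifPn; rewrite -?ltNge => ?]; lra.
Qed.

Lemma coupling_neq0 v : coupling s r v != 0 ->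
  Num.max (cumul s v.1) (cumul r v.2) < Num.min (cumul s v.1.+1) (cumul r v.2.+1).
Proof.
case: v => i j; rewrite /coupling /mincumul /=.
have := cumul_le s (leqnSn i); have := cumul_le r (leqnSn j).
move=> h1 h2; apply: contraR; rewrite -leNgt => h; apply/eqP; move: h.
by rewrite !minEle !maxEle; do ?[case: ifPn; rewrite -?ltNge => ?]; lra.
Qed.

Lemma coupling_marginals v : coupling s r v != 0 ->
  (val s 0 v.1 != 0) && (val r 0 v.2 != 0).
Proof.
move/coupling_neq0; rewrite gt_max !lt_min !cumulS.
move=> /andP[/andP[h _] /andP[_ k]].
by apply/andP; split; apply/eqP => e; move: h k; rewrite e ?addr0 ltxx.
Qed.

(** Two steps of [s] and two steps of [r] cannot meet in the opposite order;
    hence the support of a coupling is a chain. *)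
Lemma coupling_comparable u v :
  coupling s r u != 0 -> coupling s r v != 0 ->
  (u.1 < v.1)%N -> (u.2 <= v.2)%N.
Proof.
move=> /coupling_neq0 hu /coupling_neq0 hv uv; rewrite leqNgt; apply/negP => vu.
have := cumul_le s uv; have := cumul_le r vu.
by move: hu hv; rewrite !gt_max !lt_min => *; lra.
Qed.

Lemma coupling_sum_row i : \sum_j coupling s r (i, j) = val s 0 i.
Proof.
pose f (j : nat) := mincumul s r i.+1 j - mincumul s r i j.
have -> : \sum_j coupling s r (i, j) = \sum_(0 <= j < q.+1) (f j.+1 - f j).
  by rewrite big_mkord; apply: eq_bigr => j _; rewrite /coupling /f /=; ring.
rewrite telescope_sumr // /f /mincumul cumul0 (cumul_ge r (ltnSn q)).
rewrite !(min_l (cumul_le1 _ _)) !(min_r (cumul_ge0 _ _)) cumulS; ring.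
Qed.

Lemma coupling_sum_col j : \sum_i coupling s r (i, j) = val r 0 j.
Proof.
pose f (i : nat) := mincumul s r i j.+1 - mincumul s r i j.
have -> : \sum_i coupling s r (i, j) = \sum_(0 <= i < p.+1) (f i.+1 - f i).
  by rewrite big_mkord; apply: eq_bigr => i _; rewrite /coupling /f /=; ring.
rewrite telescope_sumr // /f /mincumul cumul0 (cumul_ge s (ltnSn p)).
rewrite !(min_r (cumul_le1 _ _)) !(min_l (cumul_ge0 _ _)) cumulS; ring.
Qed.

(** On a chain in the product, the sum of the two indices is injective. Adding
    the weights by this sum therefore loses nothing on the support of the
    coupling, and gives a point of a simplex of fixed dimension that
    depends continuously on [s] and [r]. *)
Definition merge_coord (h : 'I_(p + q).+1) : R :=
  \sum_(v : 'I_p.+1 * 'I_q.+1 | (v.1 + v.2 == h)%N) coupling s r v.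

Lemma merge_ge0 h : 0 <= merge_coord h.
Proof. by apply: sumr_ge0 => v _; exact: coupling_ge0. Qed.

Lemma rank_subproof (v : 'I_p.+1 * 'I_q.+1) : (v.1 + v.2 < (p + q).+1)%N.
Proof. by rewrite ltnS leq_add // -ltnS. Qed.

Definition rank v : 'I_(p + q).+1 := Ordinal (rank_subproof v).

Lemma merge_sum : \sum_h merge_coord h = 1.
Proof.
rewrite -(simplex_sum s).
under [RHS]eq_bigr => i _ do rewrite -coupling_sum_row.
by rewrite pair_bigA /= (partition_big rank xpredT).
Qed.

Definition merge : std_simplex R (p + q) := mk_simplex merge_ge0 merge_sum.

Lemma mergeE h : val merge 0 h = \sum_(v | rank v == h) coupling s r v.
Proof. by rewrite mk_simplexE. Qed.

(** [filler a b V] enlarges the chain [V] to one indexed by all sums of two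
    indices, by repeating elements of [V]. Not leaving [V] matters when only
    certain chains are allowed. *)
Definition filler (a : delta (p + q) p) (b : delta (p + q) q)
    (V : {set 'I_p.+1 * 'I_q.+1}) : Prop :=
  (forall h, (a h, b h) \in V) /\
  forall v, v \in V -> a (rank v) = v.1 /\ b (rank v) = v.2.

Definition support : {set 'I_p.+1 * 'I_q.+1} := [set v | coupling s r v != 0].

Lemma support_neq0 : exists v, v \in support.
Proof.
have [i si] := simplex_neq0 s.
apply/existsP; apply: contraNT si; rewrite negb_exists => /forallP h.
rewrite -coupling_sum_row big1 // => j _.
by apply/eqP; move: (h (i, j)); rewrite inE negbK.
Qed.

Lemma support_filler : exists a b, filler a b support.
Proof.
have [v0 Sv0] := support_neq0.
have [d [dS dfix]] := delta_retract (imset_f rank Sv0).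
pose w h := odflt v0 [pick v | (v \in support) && (rank v == d h)].
have wP h : w h \in support /\ rank (w h) = d h.
  rewrite /w; case: pickP => [v /andP[Sv /eqP //]|/= none].
  have /imsetP[v Sv e] := dS h.
  by have := none v; rewrite Sv -e eqxx.
have le_rank u v : u \in support -> v \in support -> (rank u <= rank v)%N ->
    (u.1 <= v.1)%N && (u.2 <= v.2)%N.
  rewrite !inE => Su Sv; rewrite /rank /= => uv.
  have := coupling_comparable Su Sv; have := coupling_comparable Sv Su.
  by move: uv; case: (ltngtP u.1 v.1); case: (ltngtP u.2 v.2) => //=; lia.
have w_le (h h' : 'I_(p + q).+1) : (h <= h')%N ->
    ((w h).1 <= (w h').1)%N && ((w h).2 <= (w h').2)%N.
  move=> hh'; have [[Sw e] [Sw' e']] := (wP h, wP h').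
  by apply: le_rank => //; rewrite e e'; exact: delta_homo.
have ha : {homo (fun h : 'I_(p + q).+1 => (w h).1) : h h' / (h <= h')%N}.
  by move=> h h' /w_le/andP[].
have hb : {homo (fun h : 'I_(p + q).+1 => (w h).2) : h h' / (h <= h')%N}.
  by move=> h h' /w_le/andP[].
exists (mk_delta ha), (mk_delta hb); split=> [h|v Sv] /=.
  by rewrite -surjective_pairing; have [] := wP h.
suff -> : w (rank v) = v by [].
have [Sw] := wP (rank v); rewrite dfix ?imset_f // => e.
have /andP[h1 h2] := le_rank _ _ Sw Sv (eq_leq (congr1 val e)).
have /andP[h3 h4] := le_rank _ _ Sv Sw (eq_leq (congr1 val (esym e))).
rewrite [LHS]surjective_pairing [RHS]surjective_pairing.
by congr pair; apply/ord_inj/anti_leq; rewrite ?h1 ?h2 ?h3 ?h4.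
Qed.

Lemma simplex_map_merge n (a : delta (p + q) n) (f : 'I_p.+1 * 'I_q.+1 -> 'I_n.+1) :
    (forall v, v \in support -> a (rank v) = f v) ->
  forall i, val (simplex_map a merge) 0 i = \sum_(v | f v == i) coupling s r v.
Proof.
move=> af i; rewrite simplex_mapE.
transitivity (\sum_(v | a (rank v) == i) coupling s r v).
  rewrite (partition_big rank (fun h => a h == i)) //=.
  apply: eq_bigr => h ah; rewrite mergeE; apply: eq_bigl => v.
  by rewrite andbC; case: eqP => //= ->.
rewrite big_mkcond [RHS]big_mkcond; apply: eq_bigr => v _.
have [->|Sv] := eqVneq (coupling s r v) 0; first by rewrite !if_same.
by rewrite af // inE.
Qed.

(** A filler realizes [merge] as a point with marginals [s] and [r]. *)
Lemma filler_marginals a b (V : {set 'I_p.+1 * 'I_q.+1}) :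
  filler a b V -> support \subset V ->
  simplex_map a merge = s /\ simplex_map b merge = r.
Proof.
move=> [_ fV] /fintype.subsetP sV; split; apply: simplex_ext => i.
  rewrite (simplex_map_merge (fun v Sv => (fV v (sV v Sv)).1)) -coupling_sum_row.
  transitivity (\sum_(k | k == i) \sum_l coupling s r (k, l)).
    by rewrite pair_big_dep /=; apply: eq_big => -[k l] //=; rewrite andbT.
  by rewrite big_pred1_eq.
rewrite (simplex_map_merge (fun v Sv => (fV v (sV v Sv)).2)) -coupling_sum_col.
transitivity (\sum_k \sum_(l | l == i) coupling s r (k, l)).
  by rewrite pair_big_dep /=; apply: eq_big => -[k l].
by apply: eq_bigr => k _; rewrite big_pred1_eq.
Qed.

End two_simplices.

Lemma rank_chain m p q (a : delta m p) (b : delta m q) (c : delta m (p + q))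
    (t : std_simplex R m) :
    (forall h, c h = rank (a h, b h)) ->
  simplex_map c t = merge (simplex_map a t) (simplex_map b t).
Proof.
move=> ce; apply: simplex_ext => h; rewrite simplex_mapE mergeE.
rewrite (partition_big (fun k => (a k, b k)) (fun v => rank v == h)) => [|k] /=.
  apply: eq_bigr => v vh; rewrite -coupling_chain; apply: eq_bigl => k.
  by rewrite andbC ce; case: eqP => //= ->; rewrite vh.
by rewrite ce.
Qed.

Lemma support_chain m p q (a : delta m p) (b : delta m q) (t : std_simplex R m) h :
  val t 0 h != 0 -> (a h, b h) \in support (simplex_map a t) (simplex_map b t).
Proof.
move=> th; rewrite inE -coupling_chain (bigD1 h) //=.
rewrite paddr_eq0 ?simplex_ge0 ?sumr_ge0 // => [|i _]; last exact: simplex_ge0.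
by rewrite negb_and th.
Qed.

Section continuity.
Variables (T : topologicalType) (p q : nat).
Variables (s : T -> std_simplex R p) (r : T -> std_simplex R q).
Hypotheses (s_cont : continuous s) (r_cont : continuous r).

Lemma mincumul_continuous i j : continuous (fun z => mincumul (s z) (r z) i j).
Proof.
move=> z; apply: (@continuous_min R T (fun z => cumul (s z) i)
  (fun z => cumul (r z) j) z).
  apply: (@continuous_comp _ _ _ s (fun t => cumul t i)); first exact: s_cont.
  exact: cumul_continuous.
apply: (@continuous_comp _ _ _ r (fun t => cumul t j)); first exact: r_cont.
exact: cumul_continuous.
Qed.

Lemma coupling_continuous v : continuous (fun z => coupling (s z) (r z) v).
Proof.
move=> z; apply: (@continuousD R R^o T _ (fun z => mincumul (s z) (r z) v.1 v.2));
  last exact: mincumul_continuous.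
apply: (@continuousB R R^o T _ (fun z => mincumul (s z) (r z) v.1.+1 v.2));
  last exact: mincumul_continuous.
apply: (@continuousB R R^o T _ (fun z => mincumul (s z) (r z) v.1 v.2.+1));
  exact: mincumul_continuous.
Qed.

Lemma merge_continuous : continuous (fun z => merge (s z) (r z)).
Proof.
apply: std_simplex_continuous => h.
rewrite (_ : (fun z => _) =
  fun z => \sum_(v | rank v == h) coupling (s z) (r z) v).
  by apply: sum_continuous => v; exact: coupling_continuous.
by apply/funext => z; exact: mergeE.
Qed.

End continuity.
End coupling.

(** A simplicial map to [Y] defined on the simplices of a simplicial subset
    [sub_dom] of the product of the standard simplices of dimensions [p]
    and [q]. *)
Record subprism_map (Y : sset) (p q : nat) := SubprismMap {
  sub_dom : forall m, delta m p -> delta m q -> Prop;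
  sub_fun :> forall m (a : delta m p) (b : delta m q), sub_dom a b -> Y m;
  sub_dom_comp : forall l m (c : delta l m) (a : delta m p) (b : delta m q),
    sub_dom a b -> sub_dom (delta_comp a c) (delta_comp b c);
  sub_fun_nat : forall l m (c : delta l m) (a : delta m p) (b : delta m q)
    (ab : sub_dom a b) (abc : sub_dom (delta_comp a c) (delta_comp b c)),
    ss_map Y c (sub_fun ab) = sub_fun abc }.
Arguments sub_dom {Y p q} F {m} a b : rename.
Arguments sub_fun {Y p q} F {m a b} ab : rename.

Section coupled_points.
Variables (R : realType) (Y : sset) (p q : nat) (F : subprism_map Y p q).

Lemma sub_fun_eq m (a a' : delta m p) (b b' : delta m q)
    (ab : sub_dom F a b) (ab' : sub_dom F a' b') :
  a = a' -> b = b' -> sub_fun F ab = sub_fun F ab'.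
Proof. by move=> ea eb; subst a' b'; congr sub_fun; exact: Prop_irrelevance. Qed.

(** Precompose with a retraction of the index simplex onto the support of [t]:
    it fixes [t] and makes the two chains equal. *)
Lemma cell_point_agree m (a a' : delta m p) (b b' : delta m q)
    (ab : sub_dom F a b) (ab' : sub_dom F a' b') (t : std_simplex R m) :
    (forall h, val t 0 h != 0 -> a h = a' h /\ b h = b' h) ->
  cell_point (sub_fun F ab) t = cell_point (sub_fun F ab') t.
Proof.
move=> e; have [h0 th0] := simplex_neq0 t.
have [|d [dS dfix]] := @delta_retract m [set h | val t 0 h != 0] h0.
  by rewrite inE.
have dt : simplex_map d t = t.
  rewrite -[RHS]simplex_map_id; apply: simplex_map_fix => i ti.
  by apply: dfix; rewrite inE.
rewrite -dt -!cell_point_glue !(sub_fun_nat _ (sub_dom_comp d _)).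
congr cell_point; apply: sub_fun_eq; apply: delta_ext => h /=;
  by have := dS h; rewrite inE => /e[].
Qed.

(** Every point of a chain with marginals [s] and [r] equals the one given by a
    filler and [merge s r]; so these points depend on [s] and [r] only. *)
Lemma cell_point_merge m (a : delta m p) (b : delta m q) (ab : sub_dom F a b)
    (t : std_simplex R m) A B (AB : sub_dom F A B)
    (V : {set 'I_p.+1 * 'I_q.+1}) :
    filler A B V -> support (simplex_map a t) (simplex_map b t) \subset V ->
  cell_point (sub_fun F ab) t =
  cell_point (sub_fun F AB) (merge (simplex_map a t) (simplex_map b t)).
Proof.
move=> [_ fV] /fintype.subsetP sV.
have c_homo : {homo (fun h : 'I_m.+1 => rank (a h, b h)) : h h' / (h <= h')%N}.
  by move=> h h' hh'; apply: leq_add; exact: delta_homo.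
rewrite -(@rank_chain _ _ _ _ _ _ (mk_delta c_homo)) // -cell_point_glue.
rewrite (sub_fun_nat _ (sub_dom_comp (mk_delta c_homo) AB)).
apply: cell_point_agree => h th.
by have [] := fV _ (sV _ (support_chain a b th)).
Qed.

Section coupled_map.
Variables (T : topologicalType).
Variables (s : T -> std_simplex R p) (r : T -> std_simplex R q).
Hypotheses (s_cont : continuous s) (r_cont : continuous r).
Hypothesis sr_dom : forall z m (a : delta m p) (b : delta m q),
  (forall h, val (s z) 0 (a h) != 0 /\ val (r z) 0 (b h) != 0) ->
  sub_dom F a b.

Lemma filler_dom z A B : filler A B (support (s z) (r z)) -> sub_dom F A B.
Proof.
move=> [AB _]; apply: sr_dom => h.
have := AB h; rewrite inE => /coupling_marginals/andP; exact.
Qed.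

Lemma coupled_point z : exists m (a : delta m p) (b : delta m q) t,
  [/\ sub_dom F a b, simplex_map a t = s z & simplex_map b t = r z].
Proof.
have [A [B AB]] := support_filler (s z) (r z).
have [eA eB] := filler_marginals AB (subxx _).
exists (p + q)%N, A, B, (merge (s z) (r z)); split => //.
exact: filler_dom AB.
Qed.

(** The map is continuous because its source is covered by finitely many closed
    sets, indexed by the possible supports [V] of the coupling, and on each of
    them a filler of [V] gives the formula of [cell_point_merge]. Only the sets
    [V] that are the support of some coupling count, as only those are known to
    have a filler in the domain of [F]. *)
Lemma coupled_map : exists G : T -> realization R Y, continuous G /\
  forall z m (a : delta m p) (b : delta m q) (ab : sub_dom F a b) t,
    simplex_map a t = s z -> simplex_map b t = r z ->
    G z = cell_point (sub_fun F ab) t.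
Proof.
have /choice[G GP] : forall z, exists y,
    forall m (a : delta m p) (b : delta m q) (ab : sub_dom F a b) t,
      simplex_map a t = s z -> simplex_map b t = r z ->
      y = cell_point (sub_fun F ab) t.
  move=> z; have [A [B AB]] := support_filler (s z) (r z).
  exists (cell_point (sub_fun F (filler_dom AB)) (merge (s z) (r z))).
  move=> m a b ab t ea eb.
  by rewrite (cell_point_merge ab (filler_dom AB) AB) ea eb.
exists G; split; last exact: GP.
pose D (V : {set 'I_p.+1 * 'I_q.+1}) := [set z |
  (exists z0, support (s z0) (r z0) = V) /\
  forall v, v \notin V -> coupling (s z) (r z) v = 0].
apply: (@finite_closed_pasting _ _ _ D) => [z|V C cC].
  exists (support (s z) (r z)); split; first by exists z.
  by move=> v; rewrite inE negbK => /eqP.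
have [[z0 V0]|noz] := pselect (exists z0, support (s z0) (r z0) = V); last first.
  rewrite (_ : _ `&` _ = set0); first exact: closed0.
  by apply/seteqP; split=> // z [[]].
subst V; have [A [B AB]] := support_filler (s z0) (r z0).
set V := support (s z0) (r z0) in AB *.
pose g z := cell_point (sub_fun F (filler_dom AB)) (merge (s z) (r z)).
have g_cont : continuous g.
  move=> z; apply: (@continuous_comp _ _ _ (fun z => merge (s z) (r z))).
    exact: merge_continuous.
  exact: cell_point_continuous.
rewrite (_ : _ `&` _ = \bigcap_(v in [set v | v \notin V])
    ((fun z => coupling (s z) (r z) v) @^-1` [set 0]) `&` g @^-1` C); last first.
  have gG z : (forall v, v \notin V -> coupling (s z) (r z) v = 0) -> G z = g z.
    move=> zV.
    have sV : support (s z) (r z) \subset V.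
      by apply/fintype.subsetP => v; rewrite inE; apply: contraNT => /zV ->.
    by have [eA eB] := filler_marginals AB sV; exact: GP.
  apply/seteqP; split=> z [].
    by move=> [_ zV] Gz; split=> //=; rewrite -gG.
  move=> zV gz; have {}zV v : v \notin V -> coupling (s z) (r z) v = 0.
    by move=> Vv; exact: zV.
  by split; [split => //; exists z0|rewrite /= gG].
apply: closedI; last by move/continuous_closedP: g_cont; apply.
apply: closed_bigI => v _.
have /continuous_closedP := coupling_continuous s_cont r_cont (v := v).
apply; exact: closed_eq.
Qed.

End coupled_map.
End coupled_points.

(** The maps of [coupled_map] for all cells of [X], glued to a map on the
    realization of [X] times the line of times. The operators [push1] and
    [push2] say how the two prescribed coordinates transform along a simplicial
    operator; the uniqueness of couplings gives the compatibility. *)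
Section coupled_realization.
Variables (R : realType) (X Y : sset) (p q : nat -> nat).
Variables (push1 : forall m n, delta m n -> delta (p m) (p n))
  (push2 : forall m n, delta m n -> delta (q m) (q n)).
Variables (s : forall n, std_simplex R n * R -> std_simplex R (p n))
  (r : forall n, std_simplex R n * R -> std_simplex R (q n)).
Variable F : forall n, X n -> subprism_map Y (p n) (q n).
Hypotheses (s_cont : forall n, continuous (@s n))
  (r_cont : forall n, continuous (@r n)).
Hypothesis s_nat : forall m n (c : delta m n) t v,
  simplex_map (push1 c) (s (t, v)) = s (simplex_map c t, v).
Hypothesis r_nat : forall m n (c : delta m n) t v,
  simplex_map (push2 c) (r (t, v)) = r (simplex_map c t, v).
Hypothesis F_dom : forall n (x : X n) z m (a : delta m (p n)) (b : delta m (q n)),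
  (forall h, val (s z) 0 (a h) != 0 /\ val (r z) 0 (b h) != 0) ->
  sub_dom (F x) a b.
Hypothesis F_dom_nat : forall m n (c : delta m n) (x : X n) l
  (a : delta l (p m)) (b : delta l (q m)), sub_dom (F (ss_map X c x)) a b ->
  sub_dom (F x) (delta_comp (push1 c) a) (delta_comp (push2 c) b).
Hypothesis F_nat : forall m n (c : delta m n) (x : X n) l
  (a : delta l (p m)) (b : delta l (q m)) (ab : sub_dom (F (ss_map X c x)) a b)
  (abc : sub_dom (F x) (delta_comp (push1 c) a) (delta_comp (push2 c) b)),
  sub_fun (F (ss_map X c x)) ab = sub_fun (F x) abc.

Lemma coupled_realization : exists G : realization R X * R -> realization R Y,
  continuous G /\
  forall n (x : X n) t v m (a : delta m (p n)) (b : delta m (q n))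
    (ab : sub_dom (F x) a b) u,
    simplex_map a u = s (t, v) -> simplex_map b u = r (t, v) ->
    G (cell_point x t, v) = cell_point (sub_fun (F x) ab) u.
Proof.
have H_ex : forall y : {n & X n},
    exists G : std_simplex R (projT1 y) * R -> realization R Y, continuous G /\
    forall z m (a : delta m (p (projT1 y))) (b : delta m (q (projT1 y)))
      (ab : sub_dom (F (projT2 y)) a b) t,
      simplex_map a t = s z -> simplex_map b t = r z ->
      G z = cell_point (sub_fun (F (projT2 y)) ab) t.
  move=> [n x]; apply: coupled_map; [exact: s_cont|exact: r_cont|exact: F_dom].
pose H y := sval (cid (H_ex y)).
have HP y := svalP (cid (H_ex y)).
have [||n x|m n c x t v|G [cG GE]] := @realization_lift_param R X R
  (realization R Y) (fun n x => H (existT _ n x)).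
- exact: locally_compactR.
- exact: Rhausdorff.
- by have [] := HP (existT _ n x).
- have [l [a [b [u [ab ea eb]]]]] :=
    coupled_point (@F_dom m (ss_map X c x)) (t, v).
  rewrite /H ((HP (existT _ m (ss_map X c x))).2 _ _ _ _ ab u ea eb).
  rewrite ((HP (existT _ n x)).2 _ _ _ _ (F_dom_nat ab) u).
  + by rewrite (F_nat ab (F_dom_nat ab)).
  + by rewrite simplex_map_comp ea s_nat.
  + by rewrite simplex_map_comp eb r_nat.
exists G; split=> // n x t v m a b ab u ea eb.
by rewrite GE; apply: (HP (existT _ n x)).2.
Qed.

End coupled_realization.

(** * Reparametrization of simplices *)

Section reparametrization.
Variable R : realType.

Record reparam := Reparam {
  reparam_fun :> R -> R;
  reparam0 : reparam_fun 0 = 0;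
  reparam1 : reparam_fun 1 = 1;
  reparam_homo : {homo reparam_fun : x y / x <= y} }.

Lemma reparam_ge0 (f : reparam) n (t : std_simplex R n) (i : 'I_n.+1) :
  0 <= f (cumul t i.+1) - f (cumul t i).
Proof. by rewrite subr_ge0; apply/reparam_homo/cumul_le. Qed.

Lemma reparam_sum (f : reparam) n (t : std_simplex R n) :
  \sum_(i < n.+1) (f (cumul t i.+1) - f (cumul t i)) = 1.
Proof.
rewrite -(big_mkord xpredT (fun i => f (cumul t i.+1) - f (cumul t i))).
rewrite (telescope_sumr (fun i => f (cumul t i))) // cumul0 cumul_ge //.
by rewrite reparam0 reparam1 subr0.
Qed.

Definition reparametrize (f : reparam) n (t : std_simplex R n) : std_simplex R n :=
  mk_simplex (reparam_ge0 f t) (reparam_sum f t).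

Lemma cumul_reparametrize (f : reparam) n (t : std_simplex R n) k :
  cumul (reparametrize f t) k = f (cumul t k).
Proof.
have [nk|kn] := ltnP n k; first by rewrite !cumul_ge // reparam1.
elim: k kn => [|k IH] kn; first by rewrite !cumul0 reparam0.
rewrite (cumulS _ (Ordinal (leqW kn))) IH ?(ltnW kn) // mk_simplexE /=.
by rewrite addrC subrK.
Qed.

Lemma reparametrize_natural (f : reparam) m n (a : delta m n) (t : std_simplex R m) :
  simplex_map a (reparametrize f t) = reparametrize f (simplex_map a t).
Proof.
apply: cumul_ext => k; have [l al] := @cumul_map_segment R _ _ a k.
by rewrite cumul_reparametrize !al cumul_reparametrize.
Qed.

(** Keeps times in the unit interval, so that the homotopies below are defined
    and continuous for all real times. *)
Definition clamp (v : R) : R := Num.max 0 (Num.min 1 v).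

Lemma clamp_bounds v : 0 <= clamp v <= 1.
Proof. by rewrite /clamp le_max lexx ge_max ge_min lexx ler01. Qed.

Lemma clamp0 : clamp 0 = 0.
Proof. by rewrite /clamp min_r ?ler01 // maxxx. Qed.

Lemma clamp1 : clamp 1 = 1.
Proof. by rewrite /clamp minxx max_r ?ler01. Qed.

Lemma clamp_continuous : continuous clamp.
Proof.
move=> v; apply: (@continuous_max R R^o (cst 0) (fun v => Num.min 1 v)).
  exact: cst_continuous.
apply: (@continuous_min R R^o (cst 1) id); first exact: cst_continuous.
exact: cvg_id.
Qed.

(** At time 0 the two functions below double the first and the second half of
    the interval, and at time 1 both are the identity on the interval. *)
Definition slope (v : R) := 2 - clamp v.

Lemma slope_continuous : continuous slope.
Proof.
move=> v; apply: (@continuousB R R^o R (cst 2) clamp); first exact: cst_continuous.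
exact: clamp_continuous.
Qed.

Definition front_fun (v c : R) : R := Num.min 1 (slope v * c).
Definition back_fun (v c : R) : R := Num.max 0 (1 - slope v * (1 - c)).

Program Definition front (v : R) : reparam := @Reparam (front_fun v) _ _ _.
Next Obligation. by move=> v; rewrite /front_fun mulr0 min_r ?ler01. Qed.
Next Obligation.
move=> v; rewrite /front_fun /slope mulr1 min_l //.
by have := clamp_bounds v; lra.
Qed.
Next Obligation.
move=> v c d cd; rewrite /front_fun /slope le_min !ge_min lexx /=.
have := clamp_bounds v; move: (clamp v) => w w01.
by apply/orP; right; apply: ler_wpM2l => //; lra.
Qed.

Program Definition back (v : R) : reparam := @Reparam (back_fun v) _ _ _.
Next Obligation.
move=> v; rewrite /back_fun /slope max_l //.
by have := clamp_bounds v; lra.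
Qed.
Next Obligation. by move=> v; rewrite /back_fun subrr mulr0 subr0 max_r ?ler01. Qed.
Next Obligation.
move=> v c d cd; rewrite /back_fun /slope ge_max !le_max lexx /=.
have := clamp_bounds v; move: (clamp v) => w w01.
apply/orP; right; rewrite lerD2l lerN2; apply: ler_wpM2l; lra.
Qed.

Lemma front1 n (t : std_simplex R n) : reparametrize (front 1) t = t.
Proof.
apply: cumul_ext => k; rewrite cumul_reparametrize /= /front_fun /slope clamp1.
by have := cumul_le1 t k => h; rewrite min_r; lra.
Qed.

Lemma back1 n (t : std_simplex R n) : reparametrize (back 1) t = t.
Proof.
apply: cumul_ext => k; rewrite cumul_reparametrize /= /back_fun /slope clamp1.
by have := cumul_ge0 t k => h; rewrite max_r; lra.
Qed.

(** A step that meets the first half starts before the middle, and one that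
    meets the second half ends after it. *)
Lemma front_back_support n (t : std_simplex R n) i j :
    val (reparametrize (front 0) t) 0 i != 0 ->
    val (reparametrize (back 0) t) 0 j != 0 ->
  (i <= j)%N.
Proof.
rewrite !mk_simplexE /= /front_fun /back_fun /slope clamp0 subr0 => hi hj.
rewrite leqNgt; apply/negP => ji.
have c1 : cumul t i <= cumul t i.+1 by exact: cumul_le.
have c2 : cumul t j <= cumul t j.+1 by exact: cumul_le.
have c3 : cumul t j.+1 <= cumul t i by exact: cumul_le.
have [h|h] := leP (1 / 2) (cumul t i).
  by move: hi; rewrite !min_l ?subrr ?eqxx //; lra.
by move: hj; rewrite !max_l ?subrr ?eqxx //; lra.
Qed.

Lemma reparametrize_continuous (f : R -> reparam) n :
    continuous (fun z : R * R => f z.1 z.2) ->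
  continuous (fun z : std_simplex R n * R => reparametrize (f z.2) z.1).
Proof.
move=> cf; apply: std_simplex_continuous => i.
rewrite (_ : (fun z => _) =
  fun z : std_simplex R n * R => f z.2 (cumul z.1 i.+1) - f z.2 (cumul z.1 i)).
  have c k : continuous (fun z : std_simplex R n * R => f z.2 (cumul z.1 k)).
    have c2 : continuous (fun z : std_simplex R n * R => (z.2, cumul z.1 k)).
      apply: continuous_pair => z; first exact: cvg_snd.
      apply: (@continuous_comp _ _ _ fst (fun t : std_simplex R n => cumul t k)).
        exact: cvg_fst.
      exact: cumul_continuous.
    exact: (continuous_compose c2 cf).
  by move=> z; exact: (@continuousB R R^o _ _ _ z (c i.+1 z) (c i z)).
by apply/funext => z; rewrite mk_simplexE.
Qed.

Lemma front_continuous n :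
  continuous (fun z : std_simplex R n * R => reparametrize (front z.2) z.1).
Proof.
apply: reparametrize_continuous => z.
apply: (@continuous_min R (R * R)%type (cst 1) (fun z => slope z.1 * z.2)).
  exact: cst_continuous.
apply: (@continuousM R (R * R)%type (fun z => slope z.1) snd).
  by apply: continuous_comp; [exact: cvg_fst|exact: slope_continuous].
exact: cvg_snd.
Qed.

Lemma back_continuous n :
  continuous (fun z : std_simplex R n * R => reparametrize (back z.2) z.1).
Proof.
apply: reparametrize_continuous => z.
apply: (@continuous_max R (R * R)%type (cst 0) (fun z => 1 - slope z.1 * (1 - z.2))).
  exact: cst_continuous.
apply: (@continuousB R R^o (R * R)%type (cst 1)); first exact: cst_continuous.
apply: (@continuousM R (R * R)%type (fun z => slope z.1) (fun z => 1 - z.2)).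
  by apply: continuous_comp; [exact: cvg_fst|exact: slope_continuous].
apply: (@continuousB R R^o (R * R)%type (cst 1)); first exact: cst_continuous.
exact: cvg_snd.
Qed.

End reparametrization.

(** * Homotopies on realizations of diagonals *)

Program Definition bisset_prism (B : bisset) p q (x : B p q) :
    subprism_map (diag B) p q :=
  @SubprismMap (diag B) p q (fun _ _ _ => True) (fun m a b _ => bs_map B a b x)
    _ _.
Next Obligation. by []. Qed.
Next Obligation. by move=> *; rewrite /= bs_map_comp. Qed.

(** The diagonal coordinates [(t, t)] are deformed to the front and the back
    halves of [t]. *)
Lemma spread_homotopy (R : realType) (B : bisset) :
  exists H : realization R (diag B) * R -> realization R (diag B),
  [/\ continuous H,
      forall q, H (q, 1) = q &
      forall n (x : diag B n) t m (a b : delta m n) u,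
        simplex_map a u = reparametrize (front (0 : R)) t ->
        simplex_map b u = reparametrize (back (0 : R)) t ->
        H (cell_point x t, 0) = cell_point (bs_map B a b x : diag B m) u].
Proof.
have [|||||||H [cH HE]] := @coupled_realization R (diag B) (diag B) id id
  (fun _ _ c => c) (fun _ _ c => c)
  (fun n z => reparametrize (front z.2) z.1)
  (fun n z => reparametrize (back z.2) z.1) (fun n x => bisset_prism x).
- exact: front_continuous.
- exact: back_continuous.
- by move=> *; exact: reparametrize_natural.
- by move=> *; exact: reparametrize_natural.
- by [].
- by [].
- by move=> *; rewrite /= bs_map_comp.
exists H; split=> // [q|n x t m a b u ea eb]; last exact: (HE _ _ _ _ _ _ _ I).
have [n [x [t ->]]] := cell_point_surj q.
rewrite (HE _ _ _ _ _ (delta_id n) (delta_id n) I t) /= ?bs_map_id //.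
  by rewrite front1 simplex_map_id.
by rewrite back1 simplex_map_id.
Qed.

Definition delta_cst n (e : 'I_2) : delta n 1 :=
  mk_delta (f := fun=> e) (fun _ _ _ => leqnn _).

(** A simplicial map from the product of [X] with the standard 1-simplex, whose
    [n]-simplices are pairs of an element of [X n] and an operator from [n]
    to 1. *)
Record simplicial_homotopy (X Y : sset) := SimplicialHomotopy {
  sh_fun :> forall n, X n -> delta n 1 -> Y n;
  sh_nat : forall m n (c : delta m n) (x : X n) (a : delta n 1),
    ss_map Y c (sh_fun x a) = sh_fun (ss_map X c x) (delta_comp a c) }.

Program Definition homotopy_prism (X Y : sset) (h : simplicial_homotopy X Y)
    n (x : X n) : subprism_map Y 1 n :=
  @SubprismMap Y 1 n (fun _ _ _ => True)
    (fun m a b _ => h m (ss_map X b x) a) _ _.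
Next Obligation. by []. Qed.
Next Obligation. by move=> *; rewrite /= sh_nat ss_map_comp. Qed.

Section edge.
Variable R : realType.

Definition edge_coord (v : R) (i : 'I_2) :=
  if i == ord0 then 1 - clamp v else clamp v.

Lemma edge_ge0 v i : 0 <= edge_coord v i.
Proof.
by rewrite /edge_coord; have := clamp_bounds v; case: ifP => _; lra.
Qed.

Lemma edge_sum v : \sum_i edge_coord v i = 1.
Proof. by rewrite !big_ord_recl big_ord0 addr0 /edge_coord /= subrK. Qed.

Definition edge v : std_simplex R 1 := mk_simplex (edge_ge0 v) (edge_sum v).

Lemma edge_continuous : continuous edge.
Proof.
apply: std_simplex_continuous => i.
rewrite (_ : (fun z => _) = (fun v => edge_coord v i)); last first.
  by apply/funext => v; rewrite mk_simplexE.
rewrite /edge_coord; case: (i == ord0); last exact: clamp_continuous.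
move=> v; apply: (@continuousB R R^o R (cst 1) (@clamp R)).
  exact: cst_continuous.
exact: clamp_continuous.
Qed.

Lemma simplex_map_cst n e (t : std_simplex R n) :
  simplex_map (delta_cst n e) t = edge (e%:R).
Proof.
apply: simplex_ext => i; rewrite simplex_mapE mk_simplexE /edge_coord /=.
have [->|ei] := eqVneq e i; last first.
  rewrite big_pred0_eq; move: ei.
  by case: i e => [[|[|//]] ?] [[|[|//]] ?] //= _; rewrite ?clamp0 ?clamp1 ?subrr.
rewrite simplex_sum.
by case: i => [[|[|//]] ?] //=; rewrite ?clamp0 ?clamp1 ?subr0.
Qed.

Lemma realize_homotopy (X Y : sset) (h : simplicial_homotopy X Y) :
  exists H : realization R X * R -> realization R Y, continuous H /\
    forall n (x : X n) t (e : 'I_2),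
      H (cell_point x t, e%:R) = cell_point (h n x (delta_cst n e)) t.
Proof.
have [|||||||H [cH HE]] := @coupled_realization R X Y (fun=> 1%N) id
  (fun _ _ _ => delta_id 1) (fun _ _ c => c)
  (fun n z => edge z.2) (fun n z => z.1) (fun n x => homotopy_prism h x).
- move=> n; apply: (@continuous_compose _ _ _ snd edge); last exact: edge_continuous.
  by move=> z; exact: cvg_snd.
- by move=> n z; exact: cvg_fst.
- by move=> *; exact: simplex_map_id.
- by [].
- by [].
- by [].
- move=> m n c x l a b ab abc; rewrite /= ss_map_comp.
  by congr (h _ _ _); exact: delta_ext.
exists H; split=> // n x t e.
rewrite (HE _ _ _ _ _ (delta_cst n e) (delta_id n) I t) /= ?ss_map_id //.
  exact: simplex_map_cst.
exact: simplex_map_id.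
Qed.

End edge.

(** The formal part of the argument: an inclusion [i] is a weak equivalence as
    soon as a simplicial homotopy [h] joins the identity of the diagonal of [X]
    to a map that fixes [A], and whose values have in [A] every block with all
    row indices at most all column indices. *)
Section deformation.
Variables (R : realType) (A X : bisset) (i : bisset_map A X).
Variable h : simplicial_homotopy (diag X) (diag X).
Hypothesis i_inj : forall m n, injective (bs_fun i m n).
Hypothesis h1 : forall n (x : diag X n), h n x (delta_cst n 1) = x.
Hypothesis h0 : forall n (y : diag A n),
  h n (diag_map i n y) (delta_cst n 0) = diag_map i n y.
Hypothesis h_front_back : forall n (x : diag X n) m (a b : delta m n),
  (forall u v, (a u <= b v)%N) ->
  exists y : diag A m, diag_map i m y = bs_map X a b (h n x (delta_cst n 0)).

Definition lift_dom n (x : diag X n) m (a b : delta m n) : Prop :=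
  exists y : diag A m, diag_map i m y = bs_map X a b (h n x (delta_cst n 0)).

Definition lift_fun n (x : diag X n) m (a b : delta m n) (ab : lift_dom x a b) :
  diag A m := sval (cid ab).

Lemma lift_funP n (x : diag X n) m (a b : delta m n) (ab : lift_dom x a b) :
  diag_map i m (lift_fun ab) = bs_map X a b (h n x (delta_cst n 0)).
Proof. exact: (svalP (cid ab)). Qed.

Program Definition lift_prism n (x : diag X n) : subprism_map (diag A) n n :=
  @SubprismMap (diag A) n n (@lift_dom n x) (@lift_fun n x) _ _.
Next Obligation.
move=> n x l m c a b [y ye]; exists (bs_map A c c y).
by rewrite bs_map_comp -ye /= bs_fun_nat.
Qed.
Next Obligation.
move=> n x l m c a b ab abc; apply: (@i_inj l l).
rewrite [RHS]lift_funP /= bs_fun_nat -[bs_fun i m m _]/(diag_map i m _).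
by rewrite lift_funP bs_map_comp.
Qed.

Lemma h0_natural m n (c : delta m n) (x : diag X n) :
  h m (ss_map (diag X) c x) (delta_cst m 0) =
  bs_map X c c (h n x (delta_cst n 0)).
Proof.
rewrite -[RHS]/(ss_map (diag X) c _) sh_nat; congr (h _ _ _).
exact: delta_ext.
Qed.

Lemma lift_dom_front_back n (x : diag X n) (t : std_simplex R n) m
    (a b : delta m n) :
    (forall u, val (reparametrize (front (0 : R)) t) 0 (a u) != 0 /\
               val (reparametrize (back (0 : R)) t) 0 (b u) != 0) ->
  lift_dom x a b.
Proof.
move=> ab; apply: h_front_back => u v.
exact: front_back_support (ab u).1 (ab v).2.
Qed.

(** The homotopy inverse [G] takes the point of [h x 0] with coordinates the
    front and back halves of the point. On [A] this is the starting end of the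
    spreading homotopy. On [X] it is the same end applied after that of the
    realization of [h], so running both homotopies at once joins it to the
    identity. *)
Theorem deformation_weak_equivalence : weak_equivalence R i.
Proof.
have [HA [HA_cont HA1 HA0]] := spread_homotopy R A.
have [HX [HX_cont HX1 HX0]] := spread_homotopy R X.
have [K [K_cont KE]] := realize_homotopy R h.
have s_cont n : continuous (fun z : std_simplex R n * R =>
    (z.1, 0 : R)).
  apply: continuous_pair => z; first exact: cvg_fst.
  exact: cst_continuous.
have [|||||||G [G_cont GE]] := @coupled_realization R (diag X) (diag A) id id
  (fun _ _ c => c) (fun _ _ c => c)
  (fun n z => reparametrize (front (0 : R)) z.1)
  (fun n z => reparametrize (back (0 : R)) z.1) lift_prism.
- by move=> n; exact: (continuous_compose (s_cont n) (@front_continuous R n)).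
- by move=> n; exact: (continuous_compose (s_cont n) (@back_continuous R n)).
- by move=> *; exact: reparametrize_natural.
- by move=> *; exact: reparametrize_natural.
- by move=> n x z m a b; exact: lift_dom_front_back.
- move=> m n c x l a b [y ye]; exists y.
  by rewrite ye h0_natural bs_map_comp.
- move=> m n c x l a b ab abc; apply: (@i_inj l l).
  rewrite -[LHS]/(diag_map i l (lift_fun ab)).
  rewrite -[RHS]/(diag_map i l (lift_fun abc)).
  by rewrite !lift_funP h0_natural bs_map_comp.
have gE n (x : diag X n) (t : std_simplex R n) : exists m (a b : delta m n) ab u,
    [/\ simplex_map a u = reparametrize (front (0 : R)) t,
        simplex_map b u = reparametrize (back (0 : R)) t &
        G (cell_point x t, 0) = cell_point (@lift_fun n x m a b ab) u].
  have [m [a [b [u [ab ea eb]]]]] := coupled_point (F := lift_prism x)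
    (s := reparametrize (front (0 : R)) (n := n))
    (r := reparametrize (back (0 : R)) (n := n))
    (fun z m a b => @lift_dom_front_back n x z m a b) t.
  by exists m, a, b, ab, u; split=> //; rewrite (GE _ _ _ _ _ _ _ ab u).
have K0 n (x : diag X n) t :
    K (cell_point x t, 0) = cell_point (h n x (delta_cst n 0)) t.
  exact: (KE n x t 0).
have K1 q : K (q, 1) = q.
  by have [n [x [t ->]]] := cell_point_surj q; rewrite (KE n x t 1) h1.
split; first exact: realization_map_continuous.
exists (fun q => G (q, 0)); split.
- apply: (@continuous_compose _ _ _ (fun q => (q, 0)) G) => //.
  apply: continuous_pair => z; first exact: cvg_id.
  exact: cst_continuous.
- exists HA; split=> // [|q]; first exact: continuous_subspaceT.
  have [n [y [t ->]]] := cell_point_surj q.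
  have [m [a [b [ab [u [ea eb]]]]]] := gE n (diag_map i n y) t.
  rewrite /= realization_map_point (HA0 _ _ _ _ _ _ _ ea eb) => ->.
  apply: (congr1 (fun z : diag A m => cell_point z u)); apply: (@i_inj m m).
  by rewrite -[RHS]/(diag_map i m _) lift_funP h0 bs_fun_nat.
- exists (fun z => HX (K z, z.2)); split=> [|q|q]; last by rewrite K1 HX1.
    apply: continuous_subspaceT.
    apply: (@continuous_compose _ _ _ (fun z => (K z, z.2)) HX) => //.
    by apply: continuous_pair => // z; exact: cvg_snd.
  have [n [x [t ->]]] := cell_point_surj q.
  have [m [a [b [ab [u [ea eb GE']]]]]] := gE n x t.
  by rewrite /= GE' K0 realization_map_point (HX0 _ _ _ _ _ _ _ ea eb) lift_funP.
Qed.

End deformation.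

(** * Straightening squares along a cleavage *)

Lemma arrow_comp_eq (C : category) (x y z x' y' z' : C) (f : hom x y)
    (g : hom y z) (f' : hom x' y') (g' : hom y' z') :
  Arrow f = Arrow f' -> Arrow g = Arrow g' ->
  Arrow (cat_comp g f) = Arrow (cat_comp g' f').
Proof.
move=> ef eg; have ex : x = x' := congr1 (@dom _) ef.
have ey : y = y' := congr1 (@cod _) ef; have ez : z = z' := congr1 (@cod _) eg.
by subst x' y' z'; rewrite (arrow_inj ef) (arrow_inj eg).
Qed.

Lemma arrow_id_comp (C : category) (x y z : C) (f : hom x y) (u : hom y z) :
  Arrow u = Arrow (cat_id y) -> Arrow (cat_comp u f) = Arrow f.
Proof.
by move=> eu; rewrite (arrow_comp_eq (erefl (Arrow f)) eu) cat_comp1l.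
Qed.

Lemma arrow_comp_id (C : category) (x y z : C) (u : hom x y) (f : hom y z) :
  Arrow u = Arrow (cat_id y) -> Arrow (cat_comp f u) = Arrow f.
Proof.
by move=> eu; rewrite (arrow_comp_eq eu (erefl (Arrow f))) cat_comp1r.
Qed.

Section fibrations.
Variables (E B : category) (p : functor E B).
Hypothesis p_fib : fibration_prop p.

(** Since cartesian arrows compose, they have the factorization property for
    arrows over any composite: factor through a cartesian lift of [psi], and the
    remaining problem is the vertical one of the definition. *)
Lemma cartesian_fill (e e' e'' : E) (f : hom e e') (g : hom e e'')
    (b b' b'' : B) (phi : hom b b') (psi : hom b' b'') :
    cartesian p f -> Arrow (fmor p f) = Arrow phi ->
    Arrow (fmor p g) = Arrow (cat_comp psi phi) ->
  exists! h : hom e' e'', Arrow (fmor p h) = Arrow psi /\ cat_comp h f = g.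
Proof.
move=> cf ef eg; have [pre clos] := p_fib.
have eb : p e = b := congr1 (@dom _) ef.
have eb' : p e' = b' := congr1 (@cod _) ef.
subst b b'; move/arrow_inj: ef => ef; subst phi.
have [e1 [f1 [cf1 ef1]]] := pre e' b'' psi.
have eb'' : p e1 = b'' := congr1 (@cod _) ef1.
subst b''; move/arrow_inj: ef1 => ef1; subst psi.
have [|h [[vh hfg] uh]] := clos _ _ _ f f1 cf cf1 _ g; first by rewrite fmor_comp.
exists (cat_comp h f1); split.
  by rewrite fmor_comp arrow_id_comp // -cat_compA.
move=> k [ek kfg]; have [h' [[vh' h'f1] _]] := cf1 _ k ek.
by rewrite -h'f1 (uh h') // cat_compA h'f1.
Qed.

Lemma cartesian_cancel (x y z : E) (l : hom x y) (k : hom y z) :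
  cartesian p l -> cartesian p (cat_comp k l) -> cartesian p k.
Proof.
move=> cl ckl w g eg.
have [|h [[vh hkl] uh]] := ckl w (cat_comp g l).
  by rewrite !fmor_comp; exact: arrow_comp_eq.
have [h0 [_ uh0]] := cartesian_fill (g := cat_comp g l) (psi := fmor p k) cl
  erefl (etrans (congr1 _ (fmor_comp p g l)) (arrow_comp_eq erefl eg)).
exists h; split; first split=> //.
  rewrite -(uh0 (cat_comp h k)) ?(uh0 g) // fmor_comp arrow_id_comp //.
  by rewrite -cat_compA.
by move=> h' [vh' h'k]; apply: uh; rewrite -h'k cat_compA.
Qed.

(** Uniqueness in [cartesian_fill], for data whose endpoints agree only
    propositionally. *)
Lemma fill_unique (e e1 e2 e' e1' e2' : E) (l : hom e e1) (g : hom e e2)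
    (h : hom e1 e2) (l' : hom e' e1') (g' : hom e' e2') (h' : hom e1' e2') :
    cartesian p l -> Arrow l = Arrow l' -> Arrow g = Arrow g' ->
    Arrow (fmor p h) = Arrow (fmor p h') ->
    cat_comp h l = g -> cat_comp h' l' = g' ->
  Arrow h = Arrow h'.
Proof.
move=> cl el eg eh hl h'l'.
have e0 : e = e' := congr1 (@dom _) el.
have ee1 : e1 = e1' := congr1 (@cod _) el.
have ee2 : e2 = e2' := congr1 (@cod _) eg.
subst e' e1' e2'; move/arrow_inj: el => el; move/arrow_inj: eg => eg; subst l' g'.
have [h0 [_ uh0]] := cartesian_fill (g := g) (psi := fmor p h) cl
  erefl (congr1 _ (etrans (congr1 (fmor p) (esym hl)) (fmor_comp p h l))).
by rewrite -(uh0 h) // -(uh0 h').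
Qed.

End fibrations.

Section cleavages.
Variables (xi : fibration) (S : cleavage xi).
Local Notation E := (total xi).
Local Notation p := (proj xi).

Lemma cleavage_unique (a a' : arrow E) : cleavage_set S a -> cleavage_set S a' ->
  dom a = dom a' -> farrow p a = farrow p a' -> a = a'.
Proof.
move=> Sa Sa' ed ep; have [b [_ ub]] := cleavage_lift S (mor (farrow p a)).
by rewrite -(ub a) // (ub a').
Qed.

Lemma lift_exists (e : E) (phi : arrow (base xi)) : dom phi = p e ->
  exists l : {e' & hom e e'}, cleavage_set S (Arrow (projT2 l)) /\
    Arrow (fmor p (projT2 l)) = phi.
Proof.
case: phi => [b b' phi] /= eb; subst b.
have [[e0 e' l] [[Sl /= el pl] _]] := cleavage_lift S phi; subst e0.
by exists (existT _ e' l).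
Qed.

(** Total in [phi], so that arrows with equal but not convertible domains need
    no transport; only the case [dom phi = p e] is meaningful. *)
Definition lift_along (e : E) (phi : arrow (base xi)) : {e' & hom e e'} :=
  match pselect (dom phi = p e) with
  | left h => sval (cid (lift_exists h))
  | right _ => existT _ e (cat_id e)
  end.

Lemma lift_cleavage e phi : cleavage_set S (Arrow (projT2 (lift_along e phi))).
Proof.
rewrite /lift_along; case: pselect => [h|_]; last exact: cleavage_normal.
by have [] := svalP (cid (lift_exists h)).
Qed.

Lemma lift_over e phi : dom phi = p e ->
  Arrow (fmor p (projT2 (lift_along e phi))) = phi.
Proof.
rewrite /lift_along; case: pselect => // h _.
by have [] := svalP (cid (lift_exists h)).
Qed.

Lemma lift_cartesian e phi : cartesian p (projT2 (lift_along e phi)).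
Proof. exact: cleavage_cartesian (lift_cleavage e phi). Qed.

Lemma lift_eq e e' phi phi' : e = e' -> phi = phi' ->
  Arrow (projT2 (lift_along e phi)) = Arrow (projT2 (lift_along e' phi')).
Proof. by move=> -> ->. Qed.

Lemma square_over m n (x : fibred_map (square m n) xi) (c c' : square_total m n)
    (f : hom c c') :
  Arrow (fmor p (fmor (fib_total x) f)) = Arrow (fmor (fib_base x) f.2).
Proof. exact: (congr1 (fun F => farrow F (Arrow f)) (fib_comm x)). Qed.

Section straighten.
Variables (n : nat) (x : fibred_map (square n n) xi) (a : delta n 1).
Local Notation C := (square_total n n).
Local Notation X := (fib_total x).

(** The column from which the entry at [c] is pushed forward. The operator [a]
    selects the rows to be straightened, those sent to 0; in them, the entries
    above the diagonal are pushed forward from the diagonal, and all other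
    entries from their own column, that is, not moved. *)
Definition source_col (c : C) : ord_cat n :=
  if (a c.1 == ord0) && (c.1 <= c.2)%N then c.1 else c.2.

Lemma source_col_le c : (source_col c <= c.2)%N.
Proof. by rewrite /source_col; case: ifP => [/andP[]|]. Qed.

Definition source (c : C) : C := (c.1, source_col c).

Definition source_hom (c : C) : hom (source c) c := (lexx c.1, source_col_le c).

Lemma source_col_homo (c c' : C) (f : hom c c') :
  (source_col c <= source_col c')%N.
Proof.
case: f => /= f1 f2; rewrite {2}/source_col.
case: ifP => [/andP[/eqP ac' _]|_]; last exact: leq_trans (source_col_le c) f2.
have ac : a c.1 == ord0.
  by apply/eqP/ord_inj/eqP; rewrite -leqn0; move: (delta_homo a f1); rewrite ac'.
rewrite /source_col ac /=; have [_|h] := leqP c.1 c.2; first exact: f1.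
exact: leq_trans (ltnW h) f1.
Qed.

Definition source_mor (c c' : C) (f : hom c c') : hom (source c) (source c') :=
  (f.1, source_col_homo f).

Definition base_arrow (c : C) : arrow (base xi) :=
  farrow (fib_base x) (Arrow (source_hom c).2).

Definition straight_lift (c : C) := lift_along (X (source c)) (base_arrow c).
Definition straight_ob (c : C) : E := projT1 (straight_lift c).
Definition straight_unit (c : C) : hom (X (source c)) (straight_ob c) :=
  projT2 (straight_lift c).

Lemma straight_unit_over c : Arrow (fmor p (straight_unit c)) = base_arrow c.
Proof.
apply: lift_over.
exact: (congr1 (fun F : functor _ _ => F (source c)) (esym (fib_comm x))).
Qed.

Lemma straight_unit_cartesian c : cartesian p (straight_unit c).
Proof. exact: lift_cartesian. Qed.

Lemma straight_mor_exists (c c' : C) (f : hom c c') :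
  exists h : hom (straight_ob c) (straight_ob c'),
    Arrow (fmor p h) = Arrow (fmor (fib_base x) f.2) /\
    cat_comp h (straight_unit c) =
    cat_comp (straight_unit c') (fmor X (source_mor f)).
Proof.
have [|||h [hP _]] := @cartesian_fill _ _ p (fibrationP xi) _ _ _
  (straight_unit c) (cat_comp (straight_unit c') (fmor X (source_mor f)))
  _ _ _ (fmor (fib_base x) (source_hom c).2) (fmor (fib_base x) f.2).
- exact: straight_unit_cartesian.
- exact: straight_unit_over.
- rewrite fmor_comp.
  rewrite (arrow_comp_eq (square_over x (source_mor f)) (straight_unit_over c')).
  by rewrite -!fmor_comp; congr (Arrow (fmor _ _)); exact: poset_hom_eq.
by exists h.
Qed.

(** The arrows induced by the universal property of the units; functoriality
    follows from their uniqueness. *)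
Definition straight_mor (c c' : C) (f : hom c c') :
    hom (straight_ob c) (straight_ob c') :=
  sval (cid (straight_mor_exists f)).

Lemma straight_mor_over (c c' : C) (f : hom c c') :
  Arrow (fmor p (straight_mor f)) = Arrow (fmor (fib_base x) f.2).
Proof. by have [] := svalP (cid (straight_mor_exists f)). Qed.

Lemma straight_mor_unit (c c' : C) (f : hom c c') :
  cat_comp (straight_mor f) (straight_unit c) =
  cat_comp (straight_unit c') (fmor X (source_mor f)).
Proof. by have [] := svalP (cid (straight_mor_exists f)). Qed.

Lemma straight_mor_unique (c c' : C) (f : hom c c')
    (h : hom (straight_ob c) (straight_ob c')) :
    Arrow (fmor p h) = Arrow (fmor (fib_base x) f.2) ->
    cat_comp h (straight_unit c) =
      cat_comp (straight_unit c') (fmor X (source_mor f)) ->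
  straight_mor f = h.
Proof.
move=> oh uh; apply/arrow_inj; apply: (fill_unique (fibrationP xi)
  (@straight_unit_cartesian _) erefl erefl _ (straight_mor_unit f) uh).
by rewrite straight_mor_over oh.
Qed.

Program Definition straight_total : functor C E :=
  @Functor C E straight_ob straight_mor _ _.
Next Obligation.
move=> c; apply: straight_mor_unique.
  rewrite !fmor_id; apply: (congr1 (fun b => Arrow (cat_id b))).
  exact: (congr1 (@cod _) (straight_unit_over c)).
rewrite cat_comp1l (square_hom_eq (source_mor _) (cat_id _)) fmor_id.
by rewrite cat_comp1r.
Qed.
Next Obligation.
move=> c c' c'' g f; apply: straight_mor_unique.
  rewrite !fmor_comp; apply: arrow_comp_eq; exact: straight_mor_over.
rewrite -cat_compA straight_mor_unit cat_compA straight_mor_unit -cat_compA.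
by rewrite -fmor_comp; congr (cat_comp _ (fmor _ _)); exact: square_hom_eq.
Qed.

Lemma straight_comm :
  functor_comp p straight_total = functor_comp (fib_base x) (cat_pr2 _ _).
Proof. by apply: functor_eq => -[c c' f]; exact: straight_mor_over. Qed.

Lemma straight_cartesian (c c' : C) (f : hom c c') :
  cartesian (cat_pr2 (ord_cat n) (ord_cat n)) f -> cartesian p (straight_mor f).
Proof.
move=> /square_cartesian ec; apply: (cartesian_cancel (fibrationP xi)
  (@straight_unit_cartesian c)).
rewrite straight_mor_unit; apply: (fibrationP xi).2.
  by apply: fib_cartesian; exact/square_cartesian.
exact: lift_cartesian.
Qed.

Definition straighten : fibred_map (square n n) xi :=
  @FibredMap (square n n) xi straight_total (fib_base x) straight_comm
    straight_cartesian.

Lemma straighten_id :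
    (forall c, cleavage_set S (Arrow (fmor X (source_hom c)))) ->
  straighten = x.
Proof.
move=> Sx; have ul c : Arrow (straight_unit c) = Arrow (fmor X (source_hom c)).
  apply: cleavage_unique => //; first exact: lift_cleavage.
  by rewrite /farrow /= straight_unit_over square_over.
apply: fibred_map_eq => //; apply: functor_eq => -[c c' f] /=.
apply: (fill_unique (fibrationP xi) (@straight_unit_cartesian _) (ul c) _ _
  (straight_mor_unit f) erefl).
  rewrite (arrow_comp_eq (erefl (Arrow (fmor X (source_mor f)))) (ul c')).
  by rewrite -!fmor_comp; congr (Arrow (fmor _ _)); exact: square_hom_eq.
by rewrite straight_mor_over square_over.
Qed.

End straighten.

Lemma straighten_natural m n (c : delta m n) (x : fibred_map (square n n) xi)
    (a : delta n 1) :
  fibred_comp (straighten x a) (square_map c c) =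
  straighten (fibred_comp x (square_map c c)) (delta_comp a c).
Proof.
pose C := fib_total (square_map c c).
have src u : source a (C u) = C (source (delta_comp a c) u).
  case: u => u v; congr pair; rewrite /= /source_col /=.
  case: (a (c u) == ord0) => //=; have [uv|vu] := leqP u v.
    by rewrite delta_homo.
  by case: ifP => // cuv; apply/ord_inj/anti_leq; rewrite cuv delta_homo // ltnW.
have unit u : Arrow (straight_unit x a (C u)) =
    Arrow (straight_unit (fibred_comp x (square_map c c)) (delta_comp a c) u).
  apply: lift_eq; first by rewrite src.
  have e : Arrow (source_hom a (C u)).2 =
      farrow (poset_functor c) (Arrow (source_hom (delta_comp a c) u).2).
    by apply: poset_arrow_eq => //; exact: (congr1 snd (src u)).
  exact: (congr1 (farrow (fib_base x)) e).
apply: fibred_map_eq => //; apply: functor_eq => -[u u' f] /=.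
apply: (fill_unique (fibrationP xi) (@straight_unit_cartesian _ _ _ _) (unit u) _ _
  (straight_mor_unit x a (fmor C f)) (straight_mor_unit _ _ f)).
  apply: arrow_comp_eq (unit u').
  have e : Arrow (source_mor a (fmor C f)) =
      farrow C (Arrow (source_mor (delta_comp a c) f)).
    by apply: square_arrow_eq; exact: src.
  exact: (congr1 (farrow (fib_total x)) e).
by rewrite !straight_mor_over.
Qed.

Hypothesis S_closed : closed_cleavage S.

(** In the block all entries of a row come from the same diagonal entry, and
    pushing forward to [b(j)] and then to [b(j')] is pushing forward to [b(j')],
    as the cleavage is closed. *)
Lemma straighten_cleaved m n (x : fibred_map (square n n) xi) (a b : delta m n) :
    (forall u v, (a u <= b v)%N) ->
  cleaved (square_cleavage m m) S
    (fibred_comp (straighten x (delta_cst n 0)) (square_map a b)).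
Proof.
move=> ab _ [[c c' f] /square_cleavage_setE /= ec <-].
set C := fib_total (square_map a b).
set g := fmor C f; set l := straight_unit x (delta_cst n 0).
pose k := lift_along (straight_ob x (delta_cst n 0) (C c))
  (farrow (fib_base x) (Arrow g.2)).
have ok : Arrow (fmor p (projT2 k)) = farrow (fib_base x) (Arrow g.2).
  apply: lift_over => /=.
  exact: (congr1 (fun F : functor _ _ => F (C c))
    (esym (straight_comm x (delta_cst n 0)))).
have src_eq : source (delta_cst n 0) (C c) = source (delta_cst n 0) (C c').
  by rewrite /source /source_col /= !ab ec.
have e1 : Arrow (cat_comp (straight_mor x (delta_cst n 0) g) (l (C c))) =
    Arrow (l (C c')).
  rewrite straight_mor_unit; apply: arrow_comp_id.
  have e : Arrow (source_mor (delta_cst n 0) g) =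
      Arrow (cat_id (source (delta_cst n 0) (C c'))).
    by apply: square_arrow_eq.
  rewrite -[LHS]/(farrow (fib_total x) (Arrow _)) e /farrow /=.
  by rewrite fmor_id.
have e2 : Arrow (cat_comp (projT2 k) (l (C c))) = Arrow (l (C c')).
  apply: cleavage_unique.
  - by apply: S_closed; exact: lift_cleavage.
  - exact: lift_cleavage.
  - by rewrite /= src_eq.
  rewrite /farrow /= fmor_comp (arrow_comp_eq (straight_unit_over _ _ _) ok).
  rewrite straight_unit_over /base_arrow /farrow /= -fmor_comp.
  have e : Arrow (cat_comp g.2 (source_hom (delta_cst n 0) (C c)).2) =
      Arrow (source_hom (delta_cst n 0) (C c')).2.
    by apply: poset_arrow_eq => //; exact: (congr1 snd src_eq).
  exact: (congr1 (farrow (fib_base x)) e).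
suff -> : farrow (fib_total (fibred_comp (straighten x (delta_cst n 0))
    (square_map a b))) (Arrow f) = Arrow (projT2 k) by exact: lift_cleavage.
apply: (fill_unique (fibrationP xi) (@straight_unit_cartesian _ _ _ _) erefl _ _
  erefl erefl).
  by rewrite -/(l (C c)) e1 e2.
by rewrite straight_mor_over ok.
Qed.

End cleavages.

(** No row is straightened, and pushing forward along an identity does nothing
    since the cleavage is normal. *)
Lemma straighten_cst1 (xi : fibration) (S : cleavage xi) n
    (x : fibred_map (square n n) xi) :
  straighten S x (delta_cst n 1) = x.
Proof.
apply: straighten_id => c.
have e : Arrow (source_hom (delta_cst n 1) c) = Arrow (cat_id c).
  by apply: square_arrow_eq => //; case: c.
rewrite -[Arrow _]/(farrow (fib_total x) (Arrow _)) e /farrow /= fmor_id.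
exact: cleavage_normal.
Qed.

Lemma straighten_cleaved_map (xi : fibration) (S : cleavage xi) n
    (x : fibred_map (square n n) xi) (a : delta n 1) :
  cleaved (square_cleavage n n) S x -> straighten S x a = x.
Proof.
move=> Sx; apply: straighten_id => c; apply: Sx.
by exists (Arrow (source_hom a c)) => //; exact/square_cleavage_setE.
Qed.

Definition straightening (xi : fibration) (S : cleavage xi) :
    simplicial_homotopy (diag (fibred_nerve xi)) (diag (fibred_nerve xi)) :=
  @SimplicialHomotopy (diag (fibred_nerve xi)) (diag (fibred_nerve xi))
    (fun n x a => straighten S x a)
    (fun m n c x a => straighten_natural S c x a).

Theorem mainTheorem3 (R : realType) (xi : fibration) (S : cleavage xi)
    (S_closed : closed_cleavage S) :
  weak_equivalence R (nerve_inclusion S).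
Proof.
apply: (deformation_weak_equivalence R (h := straightening S)).
- by move=> m n u v e; exact: cleaved_map_eq.
- by move=> n x; exact: straighten_cst1.
- by move=> n y; apply: straighten_cleaved_map; exact: svalP.
- move=> n x m a b ab.
  by exists (exist _ _ (straighten_cleaved S_closed (x := x) ab)).
Qed.
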